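(* Let $C,D,E$ be finite sets of positive integers, and let $f_{C,D,E}(x)=\sum_{n\ge0}a(n)x^n$, where $a(n)$ is the number of Motzkin paths of length $n$ with no upward-run of length in $C$, no downward-run of length in $D$ and no flat-run of length in $E$. With the weight enumerators $h$ and $H$ defined in the context, so that $f_{C,D,E}=h_{C,C,D,D,E,E,E}$, one has $$h_{C,C_1,D,D_1,E,E_1,E_2}=H_{C,C_1,D,D_1,E,E_1,E_2}+H_{C,C_1,D,D\cup\{0\},E,E_1,E_2}\,h_{C,C,D,D,E,E,E}\,H_{C,C\cup\{0\},D,D_1,E,E_1,E_2},$$ and $H=H_{C,C_1,D,D_1,E,E_1,E_2}$ satisfies the following, where for a set $S$ we write $S'=\{s-1: s\in S\setminus\{0\}\}$. Case 1: if $0\in E_1$, then $H=x\,H_{C,C,D,D_1,E,E_1',E_2}$. Case 2: if $0\notin E_1$ and $0\in E_2$, then $H=x\,H_{C,C_1,D,D,E,E_1,E_2'}$. In the remaining cases $0\notin E_1$ and $0\notin E_2$. Case 3: if $0\in C_1$ and $0\in D_1$, then $H=x^2\,h_{C,C_1',D,D_1',E,E,E}$. Case 4: if $0\notin C_1$ and $0\notin D_1$, then $H=H_{C,C_1\cup\{0\},D,D_1,E,E,E_2}+H_{C,C_1,D,D_1,E,E_1\cup\{0\},E_2}+1$. Case 5: if $0\notin C_1$ and $0\in D_1$, then $H=H_{C,C_1\cup\{0\},D,D_1,E,E,E_2}+H_{C,C_1,D,D_1,E,E_1\cup\{0\},E_2}$. Case 6: if $0\in C_1$ and $0\notin D_1$,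 then $H=H_{C,C_1,D,D_1\cup\{0\},E,E,E_2}+H_{C,C_1,D,D_1,E,E_1,E_2\cup\{0\}}$. Applying these rules repeatedly, starting from the original family, generates only finitely many descendants, and gives a finite system of polynomial equations with as many equations as variables. Assign to the descendants variables $x_1,\dots,x_n$, with $x_n$ representing the original family ($x$ itself is not counted as one of these variables), let $I$ be the ideal generated by the system, and take the reduced Gröbner basis of $I$ with respect to pure lexicographic order $x_1>x_2>\dots>x_n$. Given the existence of the desired nonzero polynomial $F(x,P)$ (so that the elimination ideal of $I$ in the single variable $x_n$ is not zero), the smallest element $q$ of this basis is a polynomial in $x$ and $x_n$ only, and it is zero when $x_n=f_{C,D,E}(x)$. Factor $q$ completely as $q=q_1^{d_1}\cdots q_k^{d_k}$ with $d_i\ge1$. If $k=1$, then $F(x,P):=q_1$ is the desired polynomial. Otherwise $x_n=f_{C,D,E}(x)$ satisfies $q_i=0$ for one of the factors $q_i$, and this factor can be determined using the first $m$ terms of the sequence $a(n)$ for $m$ sufficiently large; then $F(x,P):=q_i$ is the desired polynomial. Thus the procedure produces the polynomial $F(x,P)$ with $F(x,f_{C,D,E}(x))=0$.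
   Context: A Motzkin path of length $n$ is a walk in the plane from $(0,0)$ to $(n,0)$ with steps $U=(1,1)$ (up), $D=(1,-1)$ (down), $F=(1,0)$ (flat) that never goes below the $x$-axis; the empty path is the Motzkin path of length $0$. An upward-run (respectively downward-run, flat-run) of length $k\ge1$ is a block of $k$ consecutive up-steps (respectively down-steps, flat-steps) that is neither immediately preceded nor immediately followed by a step of the same kind. Paths are weighted by $x^{\text{length}}$. For sets $C_1,D_1,E_1,E_2$ of non-negative integers, $h_{C,C_1,D,D_1,E,E_1,E_2}(x)$ is the weight enumerator of the Motzkin paths such that: the initial run is not an upward-run with length in $C_1$ nor a flat-run with length in $E_1$; the initial run is an upward-run if $0\in C_1$, and a flat-run if $0\in E_1$; the final run is not a downward-run with length in $D_1$ nor a flat-run with length in $E_2$; the final run is a downward-run if $0\in D_1$, and a flat-run if $0\in E_2$; and all remaining upward-run, downward-run and flat-run lengths are not in $C$, $D$, $E$ respectively. One never has both $0\in C_1$ and $0\in E_1$, nor both $0\in D_1$ and $0\in E_2$. $H_{C,C_1,D,D_1,E,E_1,E_2}(x)$ is the weight enumerator of those paths counted by $h_{C,C_1,D,D_1,E,E_1,E_2}(x)$ that leave the $x$-axis no more than once. A Gröbner basis of an ideal $I$ in a polynomial ring, with respect to a monomial order, is a finite subset $G$ of $I$ such that the leading term of every nonzero element of $I$ is divisible by the leading term of some element of $G$; it is reduced if for every $g\in G$ no monomial of $g$ lies in the ideal generated by the leading terms of the other elements of $G$.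
   Formalization: Case 2 is proved only when 0 is in C_1 (as it always is in the procedure), since it fails in general, e.g. C=D=E=C_1=D_1=∅, E_1={1}, E_2={0}; a path consisting of a single flat-run is taken to have an initial run but no final run. *)

(* Defs.v *)
From HB Require Import structures.
From mathcomp Require Import all_boot all_order all_algebra.
From mathcomp Require Import boolp classical_sets functions cardinality.
From mathcomp Require Import mpoly.

Set Implicit Arguments.
Unset Strict Implicit.
Unset Printing Implicit Defensive.

Import GRing.Theory Num.Theory.

Local Open Scope classical_set_scope.
Local Open Scope ring_scope.

Record fps := FPS { fps_coef : nat -> rat }.

HB.instance Definition _ := gen_eqMixin fps.
HB.instance Definition _ := gen_choiceMixin fps.

Lemma fpsP (f g : fps) : (forall n, fps_coef f n = fps_coef g n) -> f = g.
Proof. by case: f g => [f] [g] /= /funext ->. Qed.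

Definition fps_add (f g : fps) := FPS (fun n => fps_coef f n + fps_coef g n).
Definition fps_opp (f : fps) := FPS (fun n => - fps_coef f n).
Definition fps_mul (f g : fps) :=
  FPS (fun n => \sum_(i < n.+1) fps_coef f i * fps_coef g (n - i)).

Definition poly_fps (p : {poly rat}) : fps := FPS (fun n => p`_n).

Lemma fps_addA : associative fps_add.
Proof. by move=> f g h; apply: fpsP => n /=; rewrite addrA. Qed.
Lemma fps_addC : commutative fps_add.
Proof. by move=> f g; apply: fpsP => n /=; rewrite addrC. Qed.
Lemma fps_add0 : left_id (poly_fps 0) fps_add.
Proof. by move=> f; apply: fpsP => n /=; rewrite coef0 add0r. Qed.
Lemma fps_addN : left_inverse (poly_fps 0) fps_opp fps_add.
Proof. by move=> f; apply: fpsP => n /=; rewrite coef0 addNr. Qed.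

HB.instance Definition _ :=
  GRing.isZmodule.Build fps fps_addA fps_addC fps_add0 fps_addN.

Definition fps_trunc (m : nat) (f : fps) : {poly rat} :=
  \poly_(n < m) fps_coef f n.

Lemma fps_mul_trunc m (f g : fps) n : (n < m)%N ->
  fps_coef (fps_mul f g) n = (fps_trunc m f * fps_trunc m g)`_n.
Proof.
move=> nm; rewrite coefM /=; apply: eq_bigr => i _.
have im : (i < m)%N by rewrite (leq_trans (ltn_ord i)).
by rewrite !coef_poly im (leq_ltn_trans (leq_subr i n) nm).
Qed.

Lemma fps_mulC : commutative fps_mul.
Proof.
by move=> f g; apply: fpsP => n; rewrite !(@fps_mul_trunc n.+1) // mulrC.
Qed.

Lemma fps_mulA : associative fps_mul.
Proof.
move=> f g h; apply: fpsP => n.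
transitivity ((fps_trunc n.+1 f * (fps_trunc n.+1 g * fps_trunc n.+1 h))`_n).
  rewrite /= coefM; apply: eq_bigr => i _.
  rewrite coef_poly ltn_ord -fps_mul_trunc //.
  by rewrite ltnS leq_subr.
rewrite mulrA /= coefM; apply: eq_bigr => i _.
by rewrite -fps_mul_trunc // coef_poly ltnS leq_subr.
Qed.

Lemma fps_mul1 : left_id (poly_fps 1) fps_mul.
Proof.
move=> f; apply: fpsP => n /=; rewrite big_ord_recl coef1 mul1r subn0.
by rewrite big1 ?addr0 // => i _; rewrite coef1 mul0r.
Qed.

Lemma fps_mulD : left_distributive fps_mul fps_add.
Proof.
move=> f g h; apply: fpsP => n /=; rewrite -big_split /=.
by apply: eq_bigr => i _; rewrite mulrDl.
Qed.

Lemma fps_oneN0 : poly_fps 1 != poly_fps 0.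
Proof.
apply/eqP => /(congr1 (fps_coef^~ 0%N)) /= /eqP.
by rewrite coef1 coef0 oner_eq0.
Qed.

HB.instance Definition _ :=
  GRing.Zmodule_isComNzRing.Build fps
    fps_mulA fps_mulC fps_mul1 fps_mulD fps_oneN0.

Lemma poly_fps_is_zmod_morphism : zmod_morphism poly_fps.
Proof. by move=> p q; apply: fpsP => n /=; rewrite coefB. Qed.
Lemma poly_fps_is_monoid_morphism : monoid_morphism poly_fps.
Proof. by split=> // p q; apply: fpsP => n /=; rewrite coefM. Qed.

HB.instance Definition _ :=
  GRing.isZmodMorphism.Build {poly rat} fps poly_fps poly_fps_is_zmod_morphism.
HB.instance Definition _ :=
  GRing.isMonoidMorphism.Build {poly rat} fps poly_fps
    poly_fps_is_monoid_morphism.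

Definition fps_x : fps := poly_fps 'X.

(* F(x, g(x)), for F in Q[x][P]: the outer variable is P, the inner one is x. *)
Definition eval_fps (F : {poly {poly rat}}) (g : fps) : fps :=
  (map_poly poly_fps F).[g].

Inductive step := Up | Down | Flat.

Definition ord_of_step (s : step) : 'I_3 :=
  match s with
  | Up => @Ordinal 3 0 isT | Down => @Ordinal 3 1 isT | Flat => @Ordinal 3 2 isT
  end.
Definition step_of_ord (i : 'I_3) : step :=
  match val i with 0%N => Up | 1%N => Down | _ => Flat end.
Lemma ord_of_stepK : cancel ord_of_step step_of_ord.
Proof. by case. Qed.

HB.instance Definition _ := Finite.copy step (can_type ord_of_stepK).

Definition height (p : seq step) : int :=
  (count_mem Up p)%:Z - (count_mem Down p)%:Z.

Definition motzkin (p : seq step) : bool :=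
  (height p == 0) && all (fun i => 0 <= height (take i p)) (iota 0 (size p)).

(* The maximal blocks of equal steps, from left to right, with their lengths. *)
Fixpoint runs (p : seq step) : seq (step * nat) :=
  if p is s :: p' then
    if runs p' is (t, k) :: r then
      if s == t then (t, k.+1) :: r else (s, 1%N) :: (t, k) :: r
    else [:: (s, 1%N)]
  else [::].

(* How many times the path leaves the x-axis. *)
Definition departures (p : seq step) : nat :=
  count (fun i => (nth Flat p i == Up) && (height (take i p) == 0))
        (iota 0 (size p)).

(* The only run of a one-run path is its initial run, and such a path has no
   final run.  This matters only for the paths F^k, whose length is then tested
   against E1 and not against E2. *)
Definition initial_run (p : seq step) : option (step * nat) := ohead (runs p).
Definition final_run (p : seq step) : option (step * nat) :=
  ohead (rev (behead (runs p))).
(* In reverse order. *)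
Definition remaining_runs (p : seq step) : seq (step * nat) :=
  behead (rev (behead (runs p))).

Definition forbidden (C D E : set nat) (s : step) : set nat :=
  match s with Up => C | Down => D | Flat => E end.

Definition avoids (C D E : set nat) (r : seq (step * nat)) : bool :=
  all (fun t => t.2 \notin forbidden C D E t.1) r.

(* The end run [o] is not an [s]-run with length in [S], and it is an [s]-run
   if 0 is in [S]. *)
Definition end_ok (s : step) (S : set nat) (o : option (step * nat)) : bool :=
  if o is Some (t, k) then
    ~~ ((t == s) && (k \in S)) && ((0%N \in S) ==> (t == s))
  else 0%N \notin S.

Definition h_path (C C1 D D1 E E1 E2 : set nat) (p : seq step) : bool :=
  [&& end_ok Up C1 (initial_run p), end_ok Flat E1 (initial_run p),
      end_ok Down D1 (final_run p), end_ok Flat E2 (final_run p)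
    & avoids C D E (remaining_runs p)].

Definition num_paths (P : pred (seq step)) (n : nat) : nat :=
  #|[pred p : n.-tuple step | motzkin p && P p]|.

Definition enumerator (P : pred (seq step)) : fps :=
  FPS (fun n => (num_paths P n)%:R).

Definition motzkin_seq (C D E : set nat) (n : nat) : nat :=
  num_paths (fun p => avoids C D E (runs p)) n.

Definition f_gf (C D E : set nat) : fps :=
  FPS (fun n => (motzkin_seq C D E n)%:R).

Definition h_gf (C C1 D D1 E E1 E2 : set nat) : fps :=
  enumerator (h_path C C1 D D1 E E1 E2).

Definition H_gf (C C1 D D1 E E1 E2 : set nat) : fps :=
  enumerator
    (fun p => h_path C C1 D D1 E E1 E2 p && (departures p <= 1)%N).

Definition with0 (S : set nat) : set nat := S `|` [set 0%N].

Definition prime_set (S : set nat) : set nat := [set s.-1 | s in S `\ 0%N].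

(* One never has both 0 in C1 and 0 in E1, nor both 0 in D1 and 0 in E2. *)
Definition admissible (C1 D1 E1 E2 : set nat) : bool :=
  ~~ ((0%N \in C1) && (0%N \in E1)) && ~~ ((0%N \in D1) && (0%N \in E2)).

(* The families, given by C1, D1, E1, E2; the sets C, D, E never change. *)
Inductive path_family :=
  | fam_h of set nat & set nat & set nat & set nat
  | fam_H of set nat & set nat & set nat & set nat.

HB.instance Definition _ := gen_eqMixin path_family.
HB.instance Definition _ := gen_choiceMixin path_family.

Definition family_gf (C D E : set nat) (s : path_family) : fps :=
  match s with
  | fam_h C1 D1 E1 E2 => h_gf C C1 D D1 E E1 E2
  | fam_H C1 D1 E1 E2 => H_gf C C1 D D1 E E1 E2
  end.

Definition original (C D E : set nat) : path_family := fam_h C D E E.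

(* The right-hand side of the rule for a family, as a list of terms: (e, l)
   stands for x^e times the product of the families in l. *)
Definition rule (C D E : set nat) (s : path_family) :
    seq (nat * seq path_family) :=
  match s with
  | fam_h C1 D1 E1 E2 =>
      [:: (0%N, [:: fam_H C1 D1 E1 E2]);
          (0%N, [:: fam_H C1 (with0 D) E1 E2; original C D E;
                    fam_H (with0 C) D1 E1 E2])]
  | fam_H C1 D1 E1 E2 =>
      if 0%N \in E1 then [:: (1%N, [:: fam_H C D1 (prime_set E1) E2])]
      else if 0%N \in E2 then [:: (1%N, [:: fam_H C1 D E1 (prime_set E2)])]
      else match 0%N \in C1, 0%N \in D1 with
      | true, true => [:: (2%N, [:: fam_h (prime_set C1) (prime_set D1) E E])]
      | false, false =>
          [:: (0%N, [:: fam_H (with0 C1) D1 E E2]);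
              (0%N, [:: fam_H C1 D1 (with0 E1) E2]);
              (0%N, [::])]
      | false, true =>
          [:: (0%N, [:: fam_H (with0 C1) D1 E E2]);
              (0%N, [:: fam_H C1 D1 (with0 E1) E2])]
      | true, false =>
          [:: (0%N, [:: fam_H C1 (with0 D1) E1 E2]);
              (0%N, [:: fam_H C1 D1 E1 (with0 E2)])]
      end
  end.

Definition children (C D E : set nat) (s : path_family) : seq path_family :=
  flatten [seq t.2 | t <- rule C D E s].

(* The original family is counted among its descendants. *)
Inductive descendant (C D E : set nat) : set path_family :=
  | descendant_original : descendant C D E (original C D E)
  | descendant_child s t : descendant C D E s -> t \in children C D E s ->
      descendant C D E t.

(* The right-hand side of the rule, evaluated in a commutative ring A. *)
Definition rule_value (A : comNzRingType) (x : A) (v : path_family -> A)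
    (C D E : set nat) (s : path_family) : A :=
  \sum_(t <- rule C D E s) x ^+ t.1 * \prod_(u <- t.2) v u.

(* The coefficient field Q(x) of the polynomial ring in x_1, ..., x_n. *)
Notation Qx := {fraction {poly rat}}.

Definition Qx_of (p : {poly rat}) : Qx := tofrac p.

(* The variables are x_1, ..., x_(n+1), so there is at least one of them; x_i is
   'X_j with j of value i - 1.  [e] lists the descendants in the order of their
   variables, the original family being last. *)
Definition variable_assignment (C D E : set nat) (n : nat)
    (e : 'I_n.+1 -> path_family) : Prop :=
  set_bij [set: 'I_n.+1] (descendant C D E) e /\ e ord_max = original C D E.

Definition var_index (n : nat) (e : 'I_n.+1 -> path_family)
    (s : path_family) : 'I_n.+1 :=
  odflt ord_max [pick i | e i == s].

Definition system (C D E : set nat) (n : nat) (e : 'I_n.+1 -> path_family)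
    (i : 'I_n.+1) : {mpoly Qx[n.+1]} :=
  'X_i - rule_value (Qx_of 'X)%:MP (fun s => 'X_(var_index e s)) C D E (e i).

Definition ideal_gen (A : comNzRingType) (B : set A) : set A :=
  [set p | exists l : seq (A * A),
     (forall t, t \in l -> B t.2) /\ p = \sum_(t <- l) t.1 * t.2].

Definition divides (A : comNzRingType) (a b : A) : Prop := exists c, b = c * a.

(* Pure lexicographic order with 'X_0 > 'X_1 > ... *)
Definition lex_lt (n : nat) (m1 m2 : 'X_{1..n}) : bool :=
  [exists i : 'I_n, (m1 i < m2 i)%N &&
    [forall j : 'I_n, (j < i)%N ==> (m1 j == m2 j)]].

Definition lex_max (n : nat) (m1 m2 : 'X_{1..n}) : 'X_{1..n} :=
  if lex_lt m1 m2 then m2 else m1.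

(* The monomial 1 is the least one, so this is the largest monomial of a nonzero
   polynomial. *)
Definition lead_mon (n : nat) (p : {mpoly Qx[n]}) : 'X_{1..n} :=
  \big[@lex_max n/0%MM]_(m <- msupp p) m.

Definition lead_term (n : nat) (p : {mpoly Qx[n]}) : {mpoly Qx[n]} :=
  p@_(lead_mon p) *: 'X_[lead_mon p].

Definition groebner_basis (n : nat) (I : set {mpoly Qx[n]})
    (G : seq {mpoly Qx[n]}) : Prop :=
  (forall g, g \in G -> I g) /\
  (forall p, I p -> p != 0 ->
     exists2 g, g \in G & divides (lead_term g) (lead_term p)).

Definition reduced_groebner_basis (n : nat) (I : set {mpoly Qx[n]})
    (G : seq {mpoly Qx[n]}) : Prop :=
  groebner_basis I G /\
  (forall g, g \in G -> forall m, m \in msupp g ->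
     ~ ideal_gen
         [set t | exists2 g', (g' \in G) && (g' != g) & t = lead_term g']
         'X_[m]).

(* The element of G with the smallest leading monomial. *)
Definition smallest_element (n : nat) (G : seq {mpoly Qx[n]})
    (q : {mpoly Qx[n]}) : Prop :=
  [/\ q \in G, q != 0 &
      forall g, g \in G -> g != 0 -> ~~ lex_lt (lead_mon g) (lead_mon q)].

Definition only_last_var (n : nat) (p : {mpoly Qx[n.+1]}) : Prop :=
  forall m, m \in msupp p -> forall i : 'I_n.+1, i != ord_max -> m i = 0%N.

Definition elimination_ideal_last (n : nat) (I : set {mpoly Qx[n.+1]}) :
    set {mpoly Qx[n.+1]} := [set p | I p /\ only_last_var p].

(* Q(x, x_(n+1)), for Q in Q[x][P]. *)
Definition in_last_var (n : nat) (Q : {poly {poly rat}}) : {mpoly Qx[n.+1]} :=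
  (map_poly (fun c => (Qx_of c)%:MP) Q).['X_ord_max].

(* [q] is Q(x, x_(n+1)) up to a unit of the coefficient field; the basis
   elements are only determined up to such a unit. *)
Definition clears (n : nat) (Q : {poly {poly rat}}) (q : {mpoly Qx[n.+1]}) :
    Prop := exists2 c : Qx, c != 0 & q = c *: in_last_var n Q.

Definition is_irreducible (A : idomainType) (p : A) : Prop :=
  [/\ p != 0, p \isn't a GRing.unit &
      forall a b, p = a * b -> a \is a GRing.unit \/ b \is a GRing.unit].

Definition associated (A : idomainType) (a b : A) : Prop :=
  exists2 u, u \is a GRing.unit & a = u * b.

Definition complete_factorization (A : idomainType) (Q : A) (k : nat)
    (q : 'I_k -> A) (d : 'I_k -> nat) : Prop :=
  [/\ forall i, is_irreducible (q i),
      forall i j, i != j -> ~ associated (q i) (q j),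
      forall i, (1 <= d i)%N &
      associated Q (\prod_(i < k) q i ^+ d i)].

Definition desired (C D E : set nat) (F : {poly {poly rat}}) : Prop :=
  F != 0 /\ eval_fps F (f_gf C D E) = 0.

(* F(x, a(0) + ... + a(m-1) x^(m-1)) = 0 modulo x^m, a condition on the first m
   terms of the sequence. *)
Definition vanishes_on_terms (C D E : set nat) (m : nat)
    (F : {poly {poly rat}}) : Prop :=
  forall t, (t < m)%N ->
    (F.[\poly_(n < m) (motzkin_seq C D E n)%:R])`_t = 0.

(* Main.v *)
Require Import Defs.
From HB Require Import structures.
From mathcomp Require Import all_boot all_order all_algebra.
From mathcomp Require Import boolp classical_sets functions cardinality.
From mathcomp Require Import mpoly.
From mathcomp Require Import zify.

Set Implicit Arguments.
Unset Strict Implicit.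
Unset Printing Implicit Defensive.

Import GRing.Theory Num.Theory.

Local Open Scope classical_set_scope.
Local Open Scope ring_scope.

(* A path that leaves the axis at least twice factors uniquely as (first arch)
   (middle) (last arch), cutting after its first return to the axis and before
   its last departure; all other rules peel off one step at an end of the path.
   Every identity is proved on words: the product of two generating functions
   counts the ways of cutting a word in two.

   For the algebraic part, clearing denominators turns a member of the ideal into
   a polynomial over Q[x] that vanishes at the enumerators, so q does too, and
   Q[[x]] being a domain, so does some factor q_i.  That factor is unique: by
   Gauss's lemma two irreducible polynomials of Q[x][P] with a common zero in
   Q[[x]] are associated.  Any other factor then takes a nonzero value at f, and
   finitely many terms of the sequence detect this. *)

(** * Generating functions of languages *)

(** The rules are not identities for arbitrary parameters: splitting needs 0 outside [E1] and [E2],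
    and the last flat step may be peeled off only when the initial run is forced upward. Hence the
    invariant [regular_family], which every descendant inherits from its parent.

    The marker 0 in an end set fits the length conditions because a run of another kind acts as a
    run of length 0 of the marked kind. Kind and length then form one membership test, and deleting
    a step lowers the set by one even when the run disappears.

    Denominators must be cleared because Q(x) does not map to Q[[x]], where [x] is not invertible.

    Dickson's lemma serves twice: it makes the minimal leading monomials finite in number, and it
    gives the well-foundedness of the lexicographic order, in which a monomial may have infinitely
    many smaller ones, so that no induction on a degree can replace it. *)

Fixpoint word_sum (n : nat) (w : seq step -> rat) : rat :=
  if n is n'.+1 then \sum_(s : step) word_sum n' (fun p => w (s :: p))
  else w [::].

Definition weight_gf (w : seq step -> rat) : fps :=
  FPS (fun n => word_sum n w).

(** Recursion on the first letter replaces sums over tuples, so that the cutting formula below can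
    be proved by induction on the length. *)
Lemma sum_tuple_word_sum n (w : seq step -> rat) :
  \sum_(p : n.-tuple step) w p = word_sum n w.
Proof.
elim: n w => [|n IHn] w /=.
  rewrite (bigD1 [tuple]) //= big1 ?addr0 // => t /eqP[].
  exact: tuple0.
under [RHS]eq_bigr do rewrite -IHn.
rewrite pair_bigA /=.
rewrite (reindex (fun x : step * n.-tuple step => [tuple of x.1 :: x.2])) //=.
exists (fun t : n.+1.-tuple step => (thead t, [tuple of behead t])) => [[s t] _|t _].
  by congr (_, _) => //; apply/val_inj.
by rewrite /= [RHS]tuple_eta; apply/val_inj.
Qed.

Lemma eq_word_sum n (w w' : seq step -> rat) :
  (forall p, size p = n -> w p = w' p) -> word_sum n w = word_sum n w'.
Proof.
elim: n w w' => [|n IHn] w w' eq_w /=; first exact: eq_w.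
by apply: eq_bigr => s _; apply: IHn => p sz_p; rewrite eq_w //= sz_p.
Qed.

Lemma word_sumD n (w w' : seq step -> rat) :
  word_sum n (fun p => w p + w' p) = word_sum n w + word_sum n w'.
Proof.
elim: n w w' => [|n IHn] w w' //=.
by rewrite -big_split /=; apply: eq_bigr => s _; rewrite IHn.
Qed.

Lemma word_sumMl n (a : rat) (w : seq step -> rat) :
  word_sum n (fun p => a * w p) = a * word_sum n w.
Proof.
elim: n w => [|n IHn] w //=.
by rewrite mulr_sumr; apply: eq_bigr => s _; rewrite IHn.
Qed.

(** Induction on the length, with [w] general: the empty left factor gives the term with [w [::]],
    and every other cut is a cut of the tail for the weight [fun p => w (s :: p)]. *)
Lemma word_sum_cut n (w w' : seq step -> rat) :
  \sum_(i < n.+1) word_sum i w * word_sum (n - i) w' =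
  word_sum n (fun p => \sum_(i < (size p).+1) w (take i p) * w' (drop i p)).
Proof.
elim: n w => [|n IHn] w /=; first by rewrite !big_ord1.
rewrite [RHS](eq_bigr (fun s => w [::] * word_sum n (fun p => w' (s :: p)) +
   \sum_(i < n.+1) word_sum i (fun p => w (s :: p)) * word_sum (n - i) w')).
  rewrite big_split /= -mulr_sumr big_ord_recl; congr (_ + _).
  rewrite exchange_big /=; apply: eq_bigr => i _.
  by rewrite -mulr_suml.
move=> s _; rewrite IHn -word_sumMl -word_sumD.
by apply: eq_word_sum => p _; rewrite big_ord_recl.
Qed.

Lemma eq_weight_gf (w w' : seq step -> rat) :
  w =1 w' -> weight_gf w = weight_gf w'.
Proof. by move=> eq_w; apply: fpsP => n; apply: eq_word_sum => p _. Qed.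

Lemma weight_gfD (w w' : seq step -> rat) :
  weight_gf w + weight_gf w' = weight_gf (fun p => w p + w' p).
Proof. by apply: fpsP => n; rewrite /= word_sumD. Qed.

Lemma weight_gfM (w w' : seq step -> rat) :
  weight_gf w * weight_gf w' =
  weight_gf (fun p => \sum_(i < (size p).+1) w (take i p) * w' (drop i p)).
Proof. by apply: fpsP => n; rewrite /= word_sum_cut. Qed.

(** Reads a power of [fps_x] as the weight of one fixed word, so that peeling off a letter becomes
    an instance of [weight_gfM]. *)
Lemma weight_gf_word (p0 : seq step) :
  weight_gf (fun p => (p == p0)%:R) = fps_x ^+ size p0.
Proof.
rewrite /fps_x -rmorphXn; apply: fpsP => n /=; rewrite coefXn.
elim: n p0 => [|n IHn] [|s p0] //=.
  apply: big1 => s _; rewrite (@eq_word_sum _ _ (fun p => 0 * 0)) //.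
  by rewrite word_sumMl mul0r.
rewrite (bigD1 s) //= big1 ?addr0 => [|t /negPf nts].
  rewrite eqSS -IHn; apply: eq_word_sum => p _.
  by rewrite eqseq_cons eqxx.
rewrite (@eq_word_sum _ _ (fun p => 0 * 0)) ?word_sumMl ?mul0r // => p _.
by rewrite eqseq_cons nts.
Qed.

Lemma enumeratorE (P : pred (seq step)) :
  enumerator P = weight_gf (fun p => (motzkin p && P p)%:R).
Proof.
apply: fpsP => n; rewrite /= -sum_tuple_word_sum /num_paths -sum1_card.
rewrite natr_sum big_mkcond /=; apply: eq_bigr => p _.
by rewrite inE; case: ifP.
Qed.

(** * Motzkin paths *)

Fixpoint motzkin_from (h : nat) (p : seq step) : bool :=
  match p with
  | [::] => h == 0%N
  | Up :: p' => motzkin_from h.+1 p'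
  | Down :: p' => if h is h'.+1 then motzkin_from h' p' else false
  | Flat :: p' => motzkin_from h p'
  end.

Fixpoint departures_from (h : nat) (p : seq step) : nat :=
  match p with
  | [::] => 0
  | Up :: p' => (h == 0) + departures_from h.+1 p'
  | Down :: p' => departures_from h.-1 p'
  | Flat :: p' => departures_from h p'
  end.

Lemma height_nil : height [::] = 0.
Proof. by []. Qed.

Lemma height_cons s p :
  height (s :: p) =
  match s with Up => 1 | Down => - 1 | Flat => 0 end + height p.
Proof. by rewrite /height; case: s => /=; lia. Qed.

Lemma addSz (h : nat) (x : int) : h.+1%:Z + x = h%:Z + (1 + x).
Proof. by rewrite -[h.+1]addn1 PoszD addrA. Qed.

Lemma addSzN1 (h : nat) (x : int) : h.+1%:Z + (-1 + x) = h%:Z + x.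
Proof. by rewrite addSz addNKr. Qed.

Lemma motzkin_fromE (h : nat) p :
  motzkin_from h p = (h%:Z + height p == 0) &&
    all (fun i => 0 <= h%:Z + height (take i p)) (iota 0 (size p)).
Proof.
elim: p h => [|s p IHp] h.
  by rewrite /= [height _]height_nil addr0 andbT.
rewrite [size _]/= [iota _ _]/= (iotaDl 1 0) [all _ _]/= all_map.
rewrite height_cons.
case: s => /=.
- rewrite IHp addSz; congr (_ && _).
  by apply: eq_all => i /=; rewrite height_cons addSz.
- case: h => [|h].
    (* A step below the axis is refuted by the next prefix or, if it is the last step, by the final
       height: the prefixes tested in [motzkin] do not include the whole path. *)
    by case: p {IHp} => [|t p] //=; rewrite andbF.
  rewrite IHp addSzN1; congr (_ && _).
  by apply: eq_all => i /=; rewrite height_cons addSzN1.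
- by rewrite IHp add0r.
Qed.

Lemma motzkinE p : motzkin p = motzkin_from 0 p.
Proof.
rewrite motzkin_fromE /motzkin add0r; congr (_ && _).
by apply: eq_all => i; rewrite add0r.
Qed.

Lemma departures_fromE (h : nat) p : motzkin_from h p ->
  count (fun i => (nth Flat p i == Up) && (h%:Z + height (take i p) == 0))
    (iota 0 (size p)) = departures_from h p.
Proof.
elim: p h => [|s p IHp] h //.
rewrite [size _]/= [iota _ _]/= (iotaDl 1 0) [count _ _]/= count_map.
case: s => /=; last 1 first.
- by move=> /IHp <-.
- move=> /IHp <-; rewrite height_nil addr0; congr (_ + _)%N; apply: eq_count => i /=.
  by rewrite height_cons addSz.
- case: h => // h /IHp <-; rewrite add0n; apply: eq_count => i /=.
  by rewrite height_cons addSzN1.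
Qed.

Lemma departuresE p : motzkin_from 0 p -> departures p = departures_from 0 p.
Proof.
move=> /departures_fromE <-; apply: eq_count => i.
by rewrite add0r.
Qed.

Lemma motzkin_from_cat h p q : motzkin_from h p ->
  motzkin_from h (p ++ q) = motzkin_from 0 q.
Proof.
elim: p h => [|[] p IHp] h /=; first by move=> /eqP->.
- exact: IHp.
- by case: h => // h; apply: IHp.
- exact: IHp.
Qed.

Lemma departures_from_cat h p q : motzkin_from h p ->
  departures_from h (p ++ q) = (departures_from h p + departures_from 0 q)%N.
Proof.
elim: p h => [|[] p IHp] h /=; first by move=> /eqP->.
- by move=> /IHp->; rewrite addnA.
- by case: h => // h; apply: IHp.
- exact: IHp.
Qed.

Lemma departures_from_eq0 p : motzkin_from 0 p -> departures_from 0 p = 0%N ->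
  p = nseq (size p) Flat.
Proof. by elim: p => [|[] p IHp] //= mp dp; rewrite -IHp. Qed.

(** The start height is general for the induction. Flat steps before the first departure stay in the
    first part. That part departs once if it starts on the axis and never if it starts above, hence
    the value [h == 0]. *)
Lemma first_return h p : motzkin_from h p ->
  (0 < h)%N || (0 < departures_from h p)%N ->
  exists p1 p2, [/\ p = rcons p1 Down ++ p2, motzkin_from h (rcons p1 Down),
    motzkin_from 0 p2 & departures_from h (rcons p1 Down) = (h == 0)].
Proof.
elim: p h => [|s p IHp] h /=; first by move=> /eqP->.
case: s => mp.
- have [p1 [p2 [-> m1 m2 d1]]] := IHp _ mp (erefl _).
  by exists (Up :: p1), p2; split; rewrite //= d1 addn0.
- case: h mp => // h mp _.
  case: h mp => [|h] mp.
    by exists [::], p; split.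
  have [p1 [p2 [-> m1 m2 d1]]] := IHp _ mp (erefl _).
  by exists (Down :: p1), p2; split.
- move=> /(IHp _ mp)[p1 [p2 [-> m1 m2 d1]]].
  by exists (Flat :: p1), p2; split.
Qed.

(** The cut is immediately before the departing [Up], so flat steps on the axis before it belong to
    the left part and those after the last arch to the right part. *)
Lemma last_departure h p : motzkin_from h p -> (0 < departures_from h p)%N ->
  exists p1 p2, [/\ p = p1 ++ Up :: p2, motzkin_from h p1,
    motzkin_from 0 (Up :: p2) & departures_from 0 (Up :: p2) = 1%N].
Proof.
elim: p h => [|s p IHp] h //=.
case: s => mp.
- case: (posnP (departures_from h.+1 p)) => [d0 | d_gt0 _].
    rewrite d0 addn0; case: eqP => // h0 _; rewrite h0 in mp d0 *.
    by exists [::], p; split; rewrite //= d0.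
  have [p1 [p2 [-> m1 m2 d2]]] := IHp _ mp d_gt0.
  by exists (Up :: p1), p2; split.
- case: h mp => // h mp /(IHp _ mp)[p1 [p2 [-> m1 m2 d2]]].
  by exists (Down :: p1), p2; split.
- move=> /(IHp _ mp)[p1 [p2 [-> m1 m2 d2]]].
  by exists (Flat :: p1), p2; split.
Qed.

(** Describes the interior of an arch: if no step leaves the axis and the last step is [Down], the
    axis is touched only at the end, and everything before can be lowered by one. *)
Lemma motzkin_from_rcons_Down h p :
  motzkin_from h.+1 (rcons p Down) && (departures_from h.+1 (rcons p Down) == 0%N)
  = motzkin_from h p.
Proof.
elim: p h => [|[] p IHp] h /=; first by rewrite andbT.
- by rewrite add0n IHp.
- case: h => [|h]; last exact: IHp.
  (* Reaching the axis early would leave only flat steps, against the final [Down]. *)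
  apply/negbTE/negP => /andP[mp /eqP/(departures_from_eq0 mp)].
  by rewrite size_rcons -[_.+1]addn1 nseqD cats1 => /eqP; rewrite eqseq_rcons andbF.
- exact: IHp.
Qed.

(** * Runs *)

Definition push_run (s : step) (r : seq (step * nat)) : seq (step * nat) :=
  if r is (t, k) :: r' then
    if s == t then (t, k.+1) :: r' else (s, 1%N) :: r
  else [:: (s, 1%N)].

Definition rpush_run (s : step) (r : seq (step * nat)) : seq (step * nat) :=
  rev (push_run s (rev r)).

Lemma runs_cons s p : runs (s :: p) = push_run s (runs p).
Proof. by rewrite /=; case: (runs p) => // -[]. Qed.

Lemma rpush_run_rcons s r t k :
  rpush_run s (rcons r (t, k)) =
  if s == t then rcons r (t, k.+1) else rcons (rcons r (t, k)) (s, 1%N).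
Proof. by rewrite /rpush_run rev_rcons /=; case: eqP; rewrite !rev_cons revK. Qed.

(** [runs] recurses from the left; the commutation of pushes at the two ends transfers its recursion
    to the right end, for the rules that modify the final run. *)
Lemma push_rpush_run a s r :
  push_run a (rpush_run s r) = rpush_run s (push_run a r).
Proof.
case: (lastP r) => [|r' [t k]].
  rewrite /rpush_run /= eq_sym; case: eqP => [->|] //=.
rewrite rpush_run_rcons; case: r' => [|[u j] r'] /=.
  by case: s; case: a; case: t.
rewrite (fun_if (rpush_run s)) -!rcons_cons !rpush_run_rcons.
by case: (s == t) => /=; case: eqP.
Qed.

Lemma runs_rcons p s : runs (rcons p s) = rpush_run s (runs p).
Proof.
elim: p => [|a p IHp] //.
by rewrite rcons_cons !runs_cons IHp push_rpush_run.
Qed.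

Lemma runs_cons_head s p : exists k r, runs (s :: p) = (s, k.+1) :: r.
Proof.
rewrite runs_cons /push_run; case: (runs p) => [|[t k] r]; first by exists 0%N, [::].
by case: eqP => [->|_]; [exists k, r | exists 0%N, ((t, k) :: r)].
Qed.

Lemma runs_eq_nil p : (runs p == [::]) = (p == [::]).
Proof. by case: p => // s p; have [k [r ->]] := runs_cons_head s p. Qed.

Lemma runs_rcons_last s p : exists k r, runs (rcons p s) = rcons r (s, k.+1).
Proof.
rewrite runs_rcons; case: (lastP (runs p)) => [|r [t k]]; first by exists 0%N, [::].
rewrite rpush_run_rcons; case: eqP => [->|_]; first by exists k, r.
by exists 0%N, (rcons r (t, k)).
Qed.

Lemma runs_cat p (a b : step) q : a != b ->
  runs (rcons p a ++ b :: q) = runs (rcons p a) ++ runs (b :: q).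
Proof.
move=> ab; elim: p => [|c p IHp].
  rewrite [rcons _ _]/= cat1s runs_cons.
  by have [k [r ->]] := runs_cons_head b q; rewrite /= (negPf ab).
rewrite rcons_cons cat_cons !(runs_cons c) IHp.
have : runs (rcons p a) != [::] by rewrite runs_eq_nil; case: (p).
by case: (runs (rcons p a)) => // -[t k] r _ /=; case: (c =P t).
Qed.

Lemma motzkin_from_rcons_Up h p : motzkin_from h (rcons p Up) = false.
Proof. by elim: p h => [|[] p IHp] [|h] //=. Qed.

(** The three shapes follow the convention on end runs: no end run, an initial run alone, or both. A
    single run must be flat, since a Motzkin path neither starts with [Down] nor ends with [Up]. *)
Variant motzkin_runs_spec (p : seq step) : Prop :=
  | MotzkinRuns0 of p = [::]
  | MotzkinRuns1 k of runs p = [:: (Flat, k.+1)]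
  | MotzkinRuns2 s k m t l of s != Down & t != Up
      & runs p = (s, k.+1) :: rcons m (t, l.+1).

Lemma motzkin_runsP p : motzkin_from 0 p -> motzkin_runs_spec p.
Proof.
case: p => [_|s p mp]; first exact: MotzkinRuns0.
have sD : s != Down by case: s mp.
have [k [r eqr]] := runs_cons_head s p.
case/lastP eqq : (s :: p) => [|q t] //; rewrite -eqq.
have tU : t != Up by move: mp; rewrite eqq; case: (t) => //; rewrite motzkin_from_rcons_Up.
have [l [r' eqr']] := runs_rcons_last t q; rewrite -eqq in eqr'.
case: r' eqr' => [|u m] eqr'.
  move: (eqr'); rewrite eqr => -[st _ _]; rewrite -st in tU eqr'.
  have sF : s = Flat by case: (s) sD tU.
  by rewrite sF in eqr' *; apply: MotzkinRuns1 eqr'.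
by move: (eqr'); rewrite eqr => -[us _]; rewrite -us in eqr'; apply: MotzkinRuns2 eqr'.
Qed.

Section HPath.
Variables C D E : set nat.

Lemma h_path_nil C1 D1 E1 E2 : h_path C C1 D D1 E E1 E2 [::] =
  [&& 0%N \notin C1, 0%N \notin E1, 0%N \notin D1 & 0%N \notin E2].
Proof. by rewrite /h_path /= andbT. Qed.

Lemma h_path1 C1 D1 E1 E2 p a : runs p = [:: a] -> h_path C C1 D D1 E E1 E2 p =
  [&& end_ok Up C1 (Some a), end_ok Flat E1 (Some a), 0%N \notin D1
    & 0%N \notin E2].
Proof.
by move=> eqr; rewrite /h_path /initial_run /final_run /remaining_runs eqr /= andbT.
Qed.

Lemma h_path2 C1 D1 E1 E2 p a m b : runs p = a :: rcons m b ->
  h_path C C1 D D1 E E1 E2 p =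
  [&& end_ok Up C1 (Some a), end_ok Flat E1 (Some a), end_ok Down D1 (Some b),
      end_ok Flat E2 (Some b) & avoids C D E m].
Proof.
move=> eqr; rewrite /h_path /initial_run /final_run /remaining_runs eqr /=.
by rewrite rev_rcons /= /avoids all_rev.
Qed.

End HPath.

Lemma mem_prime_set (S : set nat) k : (k \in prime_set S) = (k.+1 \in S).
Proof.
apply/idP/idP; rewrite !inE.
  by case=> -[|n] [Sn n0] /= <- //; case: n0.
by move=> Sk; exists k.+1.
Qed.

Lemma mem_with0S (S : set nat) k : (k.+1 \in with0 S) = (k.+1 \in S).
Proof. by apply/idP/idP; rewrite !inE /with0 /=; [case | left]. Qed.

Lemma mem_with00 (S : set nat) : (0%N \in with0 S) = true.
Proof. by apply: mem_set; right. Qed.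

(** * The rules *)

Definition lang_gf (A : pred (seq step)) : fps := weight_gf (fun p => (A p)%:R).

Lemma eq_lang_gf (A B : pred (seq step)) : A =1 B -> lang_gf A = lang_gf B.
Proof. by move=> eqAB; apply: eq_weight_gf => p; rewrite eqAB. Qed.

Lemma lang_gfD (A B P : pred (seq step)) :
  (forall p, P p = A p + B p :> nat)%N -> lang_gf P = lang_gf A + lang_gf B.
Proof.
by move=> eqP; rewrite weight_gfD; apply: eq_weight_gf => p; rewrite eqP natrD.
Qed.

Lemma lang_gf_nil : lang_gf (pred1 [::]) = 1.
Proof. exact: (weight_gf_word [::]). Qed.

Lemma lang_gf_cons (s : step) (A B : pred (seq step)) :
  A [::] = false -> (forall t q, A (t :: q) = (t == s) && B q) ->
  lang_gf A = fps_x * lang_gf B.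
Proof.
move=> A0 AS; rewrite -[fps_x]expr1 -(weight_gf_word [:: s]) weight_gfM.
apply: eq_weight_gf => -[|t q] /=; first by rewrite big_ord1 A0 mul0r.
rewrite AS !big_ord_recl /= mul0r add0r take0 drop0 big1 ?addr0.
  by rewrite eqseq_cons andbT -natrM mulnb.
move=> i _; rewrite eqseq_cons; case: q i => [|u q] [i lt_i] //=.
by rewrite andbF mul0r.
Qed.

Lemma lang_gf_rcons (s : step) (A B : pred (seq step)) :
  A [::] = false -> (forall t q, A (rcons q t) = B q && (t == s)) ->
  lang_gf A = lang_gf B * fps_x.
Proof.
move=> A0 AS; rewrite -[fps_x]expr1 -(weight_gf_word [:: s]) weight_gfM.
apply: eq_weight_gf => p; case: (lastP p) => [|q t] /=.
  by rewrite big_ord1 A0 mulr0.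
rewrite AS size_rcons !big_ord_recr /= big1 ?add0r => [|[i lt_i] _ /=].
  rewrite -cats1 take_size_cat // drop_size_cat // drop_oversize.
    by rewrite mulr0 addr0 eqseq_cons andbT -natrM mulnb.
  by rewrite size_cat addn1.
rewrite (_ : drop i _ == _ = false) ?mulr0 //; apply/negP => /eqP/(congr1 size).
by rewrite size_drop size_rcons /=; lia.
Qed.

(** A run of another kind counts as an [s]-run of length 0: this merges the two clauses of [end_ok]
    into one membership, which every rule below manipulates. *)
Lemma end_okE (s : step) S (t : step) k :
  end_ok s S (Some (t, k)) = ((if t == s then k else 0%N) \notin S).
Proof. by rewrite /=; case: (t == s); rewrite /= ?implybT ?andbT ?implybF. Qed.

Section Cases.
Variables C D E : set nat.

Definition h_lang C1 D1 E1 E2 : pred (seq step) :=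
  fun p => motzkin_from 0 p && h_path C C1 D D1 E E1 E2 p.

Definition H_lang C1 D1 E1 E2 : pred (seq step) :=
  fun p => [&& motzkin_from 0 p, (departures_from 0 p <= 1)%N
             & h_path C C1 D D1 E E1 E2 p].

Lemma h_gfE C1 D1 E1 E2 : h_gf C C1 D D1 E E1 E2 = lang_gf (h_lang C1 D1 E1 E2).
Proof.
by rewrite /h_gf enumeratorE; apply: eq_lang_gf => p; rewrite motzkinE.
Qed.

Lemma H_gfE C1 D1 E1 E2 : H_gf C C1 D D1 E E1 E2 = lang_gf (H_lang C1 D1 E1 E2).
Proof.
rewrite /H_gf enumeratorE; apply: eq_lang_gf => p; rewrite motzkinE /H_lang.
by case: (boolP (motzkin_from 0 p)) => //= /departuresE ->; rewrite andbC.
Qed.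

Lemma h_path_start C1 D1 E1 E2 s p : h_path C C1 D D1 E E1 E2 (s :: p) ->
  (0%N \in C1 -> s = Up) /\ (0%N \in E1 -> s = Flat).
Proof.
have [k [r eqr]] := runs_cons_head s p.
rewrite /h_path {1 2}/initial_run eqr => /and3P[+ + _]; rewrite [ohead _]/= !end_okE.
move=> hC hE; split=> S0; apply/eqP; apply: contraT => /negPf ne.
  by move: hC; rewrite ne S0.
by move: hE; rewrite ne S0.
Qed.

Lemma h_path_end C1 D1 E1 E2 s p : h_path C C1 D D1 E E1 E2 (rcons p s) ->
  (0%N \in D1 -> s = Down) /\ (0%N \in E2 -> s = Flat).
Proof.
have [k [r eqr]] := runs_rcons_last s p.
rewrite /h_path {1 2}/final_run eqr => /and5P[_ _ + + _].
case: r {eqr} => [|a r] /=; first by move=> /negPf-> /negPf->.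
rewrite rev_rcons [ohead _]/= !end_okE.
move=> hD hE; split=> S0; apply/eqP; apply: contraT => /negPf ne.
  by move: hD; rewrite ne S0.
by move: hE; rewrite ne S0.
Qed.

Lemma h_path_eq_initial C1 C1' D1 E1 E1' E2 p :
  end_ok Up C1 (initial_run p) = end_ok Up C1' (initial_run p) ->
  end_ok Flat E1 (initial_run p) = end_ok Flat E1' (initial_run p) ->
  h_path C C1 D D1 E E1 E2 p = h_path C C1' D D1 E E1' E2 p.
Proof. by rewrite /h_path => -> ->. Qed.

(** Deleting the first flat step shortens the initial flat-run, whence [prime_set E1]. If that run
    had length 1, the next run becomes initial; it is an upward-run that was tested against [C], and
    0 in [prime_set E1] records whether length 1 was forbidden. *)
Lemma H_gf_initial_Flat (C1 D1 E1 E2 : set nat) :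
  0%N \notin C -> 0%N \notin C1 -> 0%N \in E1 ->
  H_gf C C1 D D1 E E1 E2 = fps_x * H_gf C C D D1 E (prime_set E1) E2.
Proof.
move=> C0 C10 E10; rewrite !H_gfE; apply: (@lang_gf_cons Flat).
  by rewrite /H_lang h_path_nil E10 !andbF.
move=> t q; case: (t =P Flat) => [->|nF]; last first.
  by apply/negP => /and3P[_ _ /h_path_start[_ /(_ E10)]].
rewrite /H_lang /=; case mq: (motzkin_from 0 q) => //=; congr (_ && _).
have := runs_cons Flat q.
case: (motzkin_runsP mq) => [->|k rq|s k m u l sD uU rq].
- by move=> /h_path1->; rewrite h_path_nil !end_okE /= mem_prime_set C0 C10.
- rewrite rq => /h_path1->; rewrite (h_path1 _ _ _ _ _ _ _ rq) !end_okE /=.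
  by rewrite mem_prime_set C0 C10.
- case: s sD rq => // _ rq; rewrite rq.
    rewrite -rcons_cons => /h_path2->; rewrite (h_path2 _ _ _ _ _ _ _ rq) !end_okE /=.
    by rewrite !mem_prime_set C10; case: (k.+1 \in C); rewrite /= ?andbF.
  move=> /h_path2->; rewrite (h_path2 _ _ _ _ _ _ _ rq) !end_okE /=.
  by rewrite !mem_prime_set C0 C10.
Qed.

Lemma motzkin_from_rcons_Flat h p :
  motzkin_from h (rcons p Flat) = motzkin_from h p.
Proof. by elim: p h => [|[] p IHp] [|h] //=. Qed.

Lemma departures_from_rcons_Flat h p :
  departures_from h (rcons p Flat) = departures_from h p.
Proof. by elim: p h => [|[] p IHp] [|h] //=; rewrite IHp. Qed.

(** Mirror image of [H_gf_initial_Flat], except for flat paths: they have no final run, so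
    [0 \in E2] rejects them all on the left, while the right side could still accept a shortened
    one. The hypothesis [0 \in C1] rejects them on both sides. *)
Lemma H_gf_final_Flat (C1 D1 E1 E2 : set nat) :
  0%N \notin D -> 0%N \in C1 -> 0%N \notin D1 -> 0%N \in E2 ->
  H_gf C C1 D D1 E E1 E2 = fps_x * H_gf C C1 D D E E1 (prime_set E2).
Proof.
move=> D0 C10 D10 E20; rewrite mulrC !H_gfE; apply: (@lang_gf_rcons Flat).
  by rewrite /H_lang h_path_nil C10 !andbF.
move=> t q; case: (t =P Flat) => [->|nF]; last first.
  by rewrite andbF; apply/negP => /and3P[_ _ /h_path_end[_ /(_ E20)]].
rewrite /H_lang motzkin_from_rcons_Flat departures_from_rcons_Flat andbT.
case mq: (motzkin_from 0 q) => //=; congr (_ && _).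
have := runs_rcons q Flat.
case: (motzkin_runsP mq) => [->|k rq|s k m u l sD uU rq].
- by move=> /h_path1->; rewrite h_path_nil E20 C10 !andbF.
- rewrite rq => /h_path1->; rewrite (h_path1 _ _ _ _ _ _ _ rq) !end_okE /=.
  by rewrite E20 C10 !andbF.
- rewrite rq -rcons_cons rpush_run_rcons.
  case: u uU rq => // _ rq; rewrite [Flat == _]/= !rcons_cons => /h_path2->;
    rewrite (h_path2 _ _ _ _ _ _ _ rq) !end_okE /= ?mem_prime_set D10 ?D0 //.
  by rewrite /avoids all_rcons /=; case: (l.+1 \in D); rewrite /= ?andbF.
Qed.

(** The marks force the path to be one arch [Up :: rcons q Down] with no flat step outside it, and
    [q] ranges over Motzkin paths. Flat end runs of [q] are interior to the whole path, hence tested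
    against [E]. *)
Lemma H_gf_elevated (C1 D1 E1 E2 : set nat) :
  0%N \notin E -> 0%N \in C1 -> 0%N \in D1 -> 0%N \notin E1 -> 0%N \notin E2 ->
  H_gf C C1 D D1 E E1 E2 =
  fps_x ^+ 2 * h_gf C (prime_set C1) D (prime_set D1) E E E.
Proof.
move=> E0 C10 D10 E10 E20; rewrite H_gfE h_gfE expr2 -mulrA [fps_x * lang_gf _]mulrC.
rewrite (@lang_gf_cons Up _ (fun q => H_lang C1 D1 E1 E2 (Up :: q))); first last.
- move=> t q; case: (t =P Up) => [->//|nU].
  by apply/negP => /and3P[_ _ /h_path_start[/(_ C10)]].
- by rewrite /H_lang h_path_nil C10 !andbF.
congr (_ * _); apply: (@lang_gf_rcons Down) => // t q.
case: (t =P Down) => [->|nD]; last first.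
  by rewrite andbF -rcons_cons; apply/negP => /and3P[_ _ /h_path_end[/(_ D10)]].
(* The initial [Up] uses the single departure allowed, so the rest must not leave the axis again. *)
rewrite /H_lang andbT /= -[(1 + _ <= 1)%N]/(_ <= 0)%N leqn0 andbA.
rewrite motzkin_from_rcons_Down /h_lang; case mq: (motzkin_from 0 q) => //=.
have := runs_cons Up (rcons q Down); rewrite runs_rcons.
case: (motzkin_runsP mq) => [->|k rq|s k m u l sD uU rq].
- move=> /(h_path2 _ _ _ _ _ _ _ (m := [::]))->.
  by rewrite h_path_nil !end_okE /= !mem_prime_set E10 E20 E0 andbT.
- rewrite rq => /(h_path2 _ _ _ _ _ _ _ (m := [:: _]))->.
  rewrite (h_path1 _ _ _ _ _ _ _ rq) !end_okE /= !mem_prime_set E10 E20 ?E0 /=.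
  by rewrite !andbT [X in _ && X]andbC.
- rewrite rq -(rcons_cons (s, k.+1)) rpush_run_rcons.
  case: s sD rq => // _; case: u uU => // _ rq.
  + move=> /(h_path2 _ _ _ _ _ _ _ (m := m))->.
    by rewrite (h_path2 _ _ _ _ _ _ _ rq) !end_okE /= !mem_prime_set E10 E20 ?E0.
  + move=> /(h_path2 _ _ _ _ _ _ _ (m := rcons m _))->.
    rewrite (h_path2 _ _ _ _ _ _ _ rq) !end_okE /= !mem_prime_set E10 E20 ?E0.
    by rewrite /avoids all_rcons.
  + move=> /(h_path2 _ _ _ _ _ _ _ (m := _ :: m))->.
    rewrite (h_path2 _ _ _ _ _ _ _ rq) !end_okE /= !mem_prime_set E10 E20 ?E0 /=.
    by case: (k.+1 \in E); rewrite /= ?andbF.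
  + move=> /(h_path2 _ _ _ _ _ _ _ (m := _ :: rcons m _))->.
    rewrite (h_path2 _ _ _ _ _ _ _ rq) !end_okE /= !mem_prime_set E10 E20 ?E0 /=.
    by rewrite /avoids all_rcons /=; case: (k.+1 \in E); case: (l.+1 \in E);
      rewrite /= ?andbF.
Qed.

Lemma H_gf_initial_split (C1 D1 E1 E2 : set nat) :
  0%N \notin E -> 0%N \notin C1 -> 0%N \notin E1 -> 0%N \notin E2 ->
  H_gf C C1 D D1 E E1 E2 =
  H_gf C (with0 C1) D D1 E E E2 + H_gf C C1 D D1 E (with0 E1) E2 +
  (0%N \notin D1)%:R.
Proof.
move=> E0 C10 E10 E20; rewrite !H_gfE.
have -> : (0%N \notin D1)%:R =
    lang_gf (fun p => (p == [::]) && (0%N \notin D1)).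
  case: (0%N \notin D1); last first.
    (* The empty language is the disjoint union of two copies of itself, so its enumerator equals
       its double and is 0. *)
    apply: (@addrI _ (lang_gf (fun p => (p == [::]) && false))); rewrite addr0.
    by apply: lang_gfD => p; rewrite andbF.
  by rewrite -[LHS]lang_gf_nil; apply: eq_lang_gf => p; rewrite andbT.
rewrite (@lang_gfD (predU (H_lang (with0 C1) D1 E E2) (H_lang C1 D1 (with0 E1) E2))
   (fun p => (p == [::]) && (0%N \notin D1))).
  congr (_ + _); apply: lang_gfD => p /=.
  case: (boolP (H_lang (with0 C1) D1 E E2 p)) => //= /and3P[_ _ hU].
  suff /negPf-> : ~~ H_lang C1 D1 (with0 E1) E2 p by [].
  apply/negP => /and3P[_ _ hF]; case: p hU hF => [|s p].
    by rewrite h_path_nil mem_with00.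
  by move=> /h_path_start[/(_ (mem_with00 _))-> _] /h_path_start[_ /(_ (mem_with00 _))].
case=> [|s p] /=; first by rewrite /H_lang !h_path_nil /= !mem_with00 C10 E10 E20 !andbF andbT.
rewrite addn0; congr nat_of_bool.
have [k [r eqr]] := runs_cons_head s p; rewrite /H_lang.
case: s eqr => eqr.
- have -> : h_path C C1 D D1 E (with0 E1) E2 (Up :: p) = false.
    by apply/negP => /h_path_start[_ /(_ (mem_with00 _))].
  rewrite !andbF orbF (@h_path_eq_initial C1 (with0 C1) D1 E1 E) //;
  by rewrite /initial_run eqr [ohead _]/= !end_okE //= ?mem_with0S // E10 E0.
- by [].
- have -> : h_path C (with0 C1) D D1 E E E2 (Flat :: p) = false.
    by apply/negP => /h_path_start[/(_ (mem_with00 _))].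
  rewrite !andbF (@h_path_eq_initial C1 C1 D1 E1 (with0 E1)) //.
  by rewrite /initial_run eqr [ohead _]/= !end_okE //= ?mem_with0S.
Qed.

(** Distinguishes the last step, [Down] or [Flat]. Here [0 \in C1] excludes the empty path and the
    flat paths, so there is no constant term and a final run always exists. *)
Lemma H_gf_final_split (C1 D1 E1 E2 : set nat) :
  0%N \in C1 -> 0%N \notin D1 -> 0%N \notin E2 ->
  H_gf C C1 D D1 E E1 E2 =
  H_gf C C1 D (with0 D1) E E1 E2 + H_gf C C1 D D1 E E1 (with0 E2).
Proof.
move=> C10 D10 E20; rewrite !H_gfE; apply: lang_gfD => p.
case/lastP: p => [|p s]; first by rewrite /H_lang !h_path_nil C10.
have [k [r eqr]] := runs_rcons_last s p; rewrite /H_lang.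
case: s eqr => eqr; first by rewrite motzkin_from_rcons_Up.
- have -> : h_path C C1 D D1 E E1 (with0 E2) (rcons p Down) = false.
    by apply/negP => /h_path_end[_ /(_ (mem_with00 _))].
  rewrite !andbF addn0; case: r eqr => [|a r] eqr.
    by rewrite !(h_path1 _ _ _ _ _ _ _ eqr) !end_okE /= C10.
  by rewrite !(h_path2 _ _ _ _ _ _ _ eqr) !end_okE /= mem_with0S.
- have -> : h_path C C1 D (with0 D1) E E1 E2 (rcons p Flat) = false.
    by apply/negP => /h_path_end[/(_ (mem_with00 _))].
  rewrite !andbF add0n; case: r eqr => [|a r] eqr.
    by rewrite !(h_path1 _ _ _ _ _ _ _ eqr) !end_okE /= C10.
  by rewrite !(h_path2 _ _ _ _ _ _ _ eqr) !end_okE /= mem_with0S.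
Qed.

(** An initial run is never downward and a final run never upward, so testing the ends against the
    same [C], [D], [E] is the test of all runs. *)
Lemma h_path_original p : 0%N \notin C -> 0%N \notin D -> 0%N \notin E ->
  motzkin_from 0 p -> h_path C C D D E E E p = avoids C D E (runs p).
Proof.
move=> C0 D0 E0 mp.
case: (motzkin_runsP mp) => [->|k rp|s k m u l sD uU rp].
- by rewrite h_path_nil C0 D0 E0.
- by rewrite (h_path1 _ _ _ _ _ _ _ rp) rp !end_okE /= C0 D0 E0 !andbT.
rewrite (h_path2 _ _ _ _ _ _ _ rp) rp !end_okE /avoids /= all_rcons /=.
by case: s sD rp => // _; case: u uU => //= _ _; rewrite ?C0 ?D0 ?E0 /=;
  case: (k.+1 \in _); case: (l.+1 \in _); rewrite /= ?andbF.
Qed.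

Lemma f_gfE : 0%N \notin C -> 0%N \notin D -> 0%N \notin E ->
  f_gf C D E = h_gf C C D D E E E.
Proof.
move=> C0 D0 E0; rewrite h_gfE -[LHS]/(enumerator (fun p => avoids C D E (runs p))).
rewrite enumeratorE; apply: eq_lang_gf => p; rewrite motzkinE /h_lang.
by case mp: (motzkin_from 0 p) => //=; rewrite h_path_original.
Qed.

End Cases.

(** Product formula for an unambiguous concatenation. Two cuts of one word differ by a factor [r]
    that passes from the right part to the left part, so uniqueness of the cut is expressed by [r]
    being empty. *)
Lemma lang_gf_cat (A A1 A2 : pred (seq step)) :
  (forall p, A p <-> exists p1 p2, [/\ p = p1 ++ p2, A1 p1 & A2 p2]) ->
  (forall p1 r p2, A1 p1 -> A2 (r ++ p2) -> A1 (p1 ++ r) -> A2 p2 -> r = [::]) ->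
  lang_gf A = lang_gf A1 * lang_gf A2.
Proof.
move=> AP uniq_cut; rewrite weight_gfM; apply: eq_weight_gf => p.
under eq_bigr do rewrite -natrM mulnb.
case: (boolP (A p)) => [/AP[p1 [p2 [-> A1p1 A2p2]]]|nAp]; last first.
  rewrite big1 // => i _; case: (boolP (_ && _)) => // /andP[A1i A2i].
  case/negP: nAp; apply/AP; exists (take i p), (drop i p).
  by rewrite cat_take_drop.
have lt1 : (size p1 < (size (p1 ++ p2)).+1)%N by rewrite ltnS size_cat leq_addr.
rewrite (bigD1 (Ordinal lt1)) //= take_size_cat // drop_size_cat // A1p1 A2p2.
rewrite big1 ?addr0 // => -[i lt_i] /=; rewrite -val_eqE /= => ne_i.
case: (boolP (_ && _)) => // /andP[]; rewrite take_cat drop_cat.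
case: ltngtP ne_i => // [lt_i1 _ A1i A2i|gt_i1 _ A1i A2i].
  have r0 : drop i p1 = [::].
    by apply: uniq_cut A1i A2i _ A2p2; rewrite cat_take_drop.
  by move: (congr1 size r0); rewrite size_drop /=; lia.
have r0 : take (i - size p1) p2 = [::].
  by apply: uniq_cut A1p1 _ A1i A2i; rewrite cat_take_drop.
rewrite size_cat ltnS in lt_i.
by move: (congr1 size r0); rewrite size_takel /=; lia.
Qed.

Lemma motzkin_from_inj h h' p : motzkin_from h p -> motzkin_from h' p -> h = h'.
Proof.
elim: p h h' => [|[] p IHp] h h' /=; first by move=> /eqP-> /eqP->.
- by move=> mp /(IHp _ _ mp)[].
- by case: h h' => [|h] [|h'] // mp /(IHp _ _ mp)->.
- exact: IHp.
Qed.

Lemma motzkin_from_catl h r p :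
  motzkin_from h (r ++ p) -> motzkin_from 0 p -> motzkin_from h r.
Proof.
elim: r h => [|[] r IHr] h /=.
- by move=> mp /(motzkin_from_inj mp)->.
- exact: IHr.
- by case: h => // h; apply: IHr.
- exact: IHr.
Qed.

Lemma runs_cat_motzkin p q : motzkin_from 0 p -> motzkin_from 0 q ->
  (last Flat p == Down) || (head Flat q == Up) ->
  runs (p ++ q) = runs p ++ runs q.
Proof.
case/lastP: p => [|p a] mp; first by [].
case: q => [|b q] mq; first by rewrite !cats0.
rewrite last_rcons /= => DU; apply: runs_cat.
case: a mp DU => mp; case: b mq => //= mq.
by rewrite motzkin_from_rcons_Up in mp.
Qed.

(** * Decomposition into first arch, middle and last arch *)

Section Split.
Variables C D E : set nat.
Hypotheses (C0 : 0%N \notin C) (D0 : 0%N \notin D) (E0 : 0%N \notin E).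
Variables C1 D1 E1 E2 : set nat.
Hypotheses (E10 : 0%N \notin E1) (E20 : 0%N \notin E2).

Let L1 := H_lang C D E C1 (with0 D) E1 E2.
Let L2 := h_lang C D E C D E E.
Let L3 := H_lang C D E (with0 C) D1 E1 E2.

(** Both cuts fall between two runs, because a Motzkin path neither starts with [Down] nor ends with
    [Up]. The final run of [p1] and the initial run of [p3] are interior to the whole path, hence
    the sets [D] and [C] there, with 0 added to fix the kind. *)
Lemma h_path_cat3 q1 p2 q3 (p1 := rcons q1 Down) (p3 := Up :: q3) :
  motzkin_from 0 p1 -> motzkin_from 0 p2 -> motzkin_from 0 p3 ->
  h_path C C1 D D1 E E1 E2 (p1 ++ p2 ++ p3) =
  [&& h_path C C1 D (with0 D) E E1 E2 p1, h_path C C D D E E E p2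
    & h_path C (with0 C) D D1 E E1 E2 p3].
Proof.
move=> m1 m2 m3; rewrite (h_path_original C0 D0 E0 m2).
have m23 : motzkin_from 0 (p2 ++ p3) by rewrite motzkin_from_cat.
have := runs_cat_motzkin m1 m23; rewrite last_rcons eqxx => /(_ isT).
rewrite (runs_cat_motzkin m2 m3) ?orbT //.
case: (motzkin_runsP m1) => [||].
- by rewrite /p1; case: (q1).
- move=> k; have [l [r ->]] := runs_rcons_last Down q1.
  by rewrite -[RHS]/(rcons [::] (Flat, k.+1)) => /rcons_inj[].
move=> s k m u l sD uU r1.
have {}uU : u = Down.
  have [l' [r' r1']] := runs_rcons_last Down q1.
  by move: r1'; rewrite -/p1 r1 -rcons_cons => /rcons_inj[].
subst u; case: (motzkin_runsP m3) => [//|k3 r3|s3 k3 m3' u3 l3 _ u3U r3].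
  by have [l' [r' r3']] := runs_cons_head Up q3; move: r3'; rewrite -/p3 r3.
have s3U : s3 = Up.
  by have [l' [r' r3']] := runs_cons_head Up q3; move: r3'; rewrite -/p3 r3 => -[].
subst s3; rewrite r1 r3 => rp.
have {}rp : runs (p1 ++ p2 ++ p3) = (s, k.+1) ::
    rcons (m ++ (Down, l.+1) :: runs p2 ++ (Up, k3.+1) :: m3') (u3, l3.+1).
  by rewrite rp cat_cons cat_rcons rcons_cat rcons_cons rcons_cat rcons_cons.
rewrite (h_path2 _ _ _ _ _ _ _ rp) (h_path2 _ _ _ _ _ _ _ r1) (h_path2 _ _ _ _ _ _ _ r3).
rewrite !end_okE /= !mem_with0S (negPf E10) (negPf E20) /= /avoids.
rewrite all_cat /= all_cat /=.
rewrite -!andbA; do 2 congr (_ && _).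
by case: (l.+1 \in D); case: (all _ m); case: (all _ (runs p2));
  case: (k3.+1 \in C); rewrite /= ?andbF.
Qed.

(** The 0 in [with0 D] forces a final [Down], which a path without departure, being flat, cannot
    have; so the bound on departures is attained. *)
Lemma first_arch_langP p : L1 p ->
  [/\ motzkin_from 0 p, departures_from 0 p = 1%N & exists q, p = rcons q Down].
Proof.
case/and3P=> mp dp hp; split=> //; case/lastP: p mp dp hp => [|q t] mp dp hp.
- by rewrite h_path_nil mem_with00 !andbF in hp.
- move: hp => /h_path_end[/(_ (mem_with00 _)) tD _]; rewrite {}tD in mp dp *.
  apply/eqP; rewrite eqn_leq dp lt0n; apply/negP => /eqP/(departures_from_eq0 mp).
  by rewrite size_rcons -[_.+1]addn1 nseqD cats1 => /eqP; rewrite eqseq_rcons andbF.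
- by rewrite h_path_nil mem_with00 !andbF in hp.
- move: hp => /h_path_end[/(_ (mem_with00 _)) -> _]; by exists q.
Qed.

Lemma last_arch_langP p : L3 p ->
  [/\ motzkin_from 0 p, departures_from 0 p = 1%N & exists q, p = Up :: q].
Proof.
case/and3P; case: p => [|t q] mp dp hp; first by rewrite h_path_nil mem_with00 in hp.
move: hp => /h_path_start[/(_ (mem_with00 _)) tU _]; rewrite {}tU in mp dp *.
by split=> //; [apply/eqP; rewrite eqn_leq dp | exists q].
Qed.

Lemma h_gf_split :
  h_gf C C1 D D1 E E1 E2 =
    H_gf C C1 D D1 E E1 E2
    + H_gf C C1 D (with0 D) E E1 E2 * h_gf C C D D E E E
      * H_gf C (with0 C) D D1 E E1 E2.
Proof.
rewrite !H_gfE !h_gfE.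
(* The triple product is treated as two binary concatenations; [L12] consists of a first arch
   followed by a middle. *)
pose L12 p := `[< exists p1 p2, [/\ p = p1 ++ p2, L1 p1 & L2 p2] >].
rewrite -[lang_gf L1 * lang_gf L2](@lang_gf_cat L12); first last.
(* With one departure in each of [p1] and [p1 ++ r], the factor [r] is flat, whereas [p1 ++ r] ends
   with [Down]. *)
- move=> p1 r p2 /first_arch_langP[m1 d1 _] _ /first_arch_langP[m1r d1r [q eqq]] _.
  have mr : motzkin_from 0 r by rewrite -(motzkin_from_cat _ m1).
  have dr : departures_from 0 r = 0%N.
    by apply/eqP; rewrite -(eqn_add2l 1) -{1}d1 -departures_from_cat // d1r.
  case/lastP: r eqq mr dr {m1r d1r} => // r t; rewrite -rcons_cat => /rcons_inj[_ ->].
  move=> mr /(departures_from_eq0 mr).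
  by rewrite size_rcons -[_.+1]addn1 nseqD cats1 => /eqP; rewrite eqseq_rcons andbF.
- by move=> p; split=> [/asboolP|? ] //; apply/asboolP.
rewrite -[lang_gf L12 * lang_gf L3](@lang_gf_cat
    (fun p => h_lang C D E C1 D1 E1 E2 p && (1 < departures_from 0 p)%N)); first last.
(* Here [r] has no departure, but a nonempty [r] would start with the [Up] of [r ++ p3]. *)
- move=> p12 r p3 _ /last_arch_langP[mr dr [q eqq]] _ /last_arch_langP[m3 d3 _].
  have mr' := motzkin_from_catl mr m3.
  have : departures_from 0 r = 0%N.
    by apply/eqP; rewrite -(eqn_add2r 1) -{1}d3 -departures_from_cat // dr.
  by case: r eqq {mr dr mr'} => // t r [->].
- move=> p; split=> [/andP[/andP[mp hp] dp]|[p12 [p3 [-> /asboolP]]]]; last first.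
    case=> p1 [p2 [-> Lp1 Lp2]] Lp3; rewrite -catA.
    have [m1 d1 [q1 eq1]] := first_arch_langP Lp1.
    have [m3 d3 [q3 eq3]] := last_arch_langP Lp3.
    move: (Lp1) (Lp2) (Lp3) => /and3P[_ _ h1] /andP[m2 h2] /and3P[_ _ h3].
    rewrite !departures_from_cat // d1 d3 addnCA addnC ltnS leq_addr andbT.
    rewrite /h_lang motzkin_from_cat // motzkin_from_cat // m3.
    by move: m1 m3 h1 h3; rewrite eq1 eq3 => m1 m3 h1 h3; rewrite h_path_cat3 // h1 h2.
  have [q1 [r [eqp m1 mr d1]]] := first_return mp (ltnW dp).
  have dr : (0 < departures_from 0 r)%N.
    by move: dp; rewrite eqp departures_from_cat // d1.
  have [p2 [q3 [eqr m2 m3 d3]]] := last_departure mr dr.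
  move: hp; rewrite eqp eqr h_path_cat3 // => /and3P[h1 h2 h3].
  exists (rcons q1 Down ++ p2), (Up :: q3); rewrite -catA; split=> //.
    apply/asboolP; exists (rcons q1 Down), p2; split=> //.
      by rewrite /L1 /H_lang m1 d1.
    by rewrite /L2 /h_lang m2.
  by rewrite /L3 /H_lang m3 d3.
apply: lang_gfD => p; rewrite /h_lang /H_lang.
by case: (motzkin_from 0 p) => //=; case: ltnP => /=; rewrite ?andbT ?andbF ?addn0.
Qed.

End Split.

(** * Finiteness of the descendants *)

Section Descendants.
Variables C D E : set nat.
Hypotheses (C0 : 0%N \notin C) (D0 : 0%N \notin D) (E0 : 0%N \notin E).

(** The invariant under which each rule is an identity. The implication records that 0 enters [E2]
    only in Case 6, where [C1] contains 0, and that [C1] keeps it as long as [E2] does. *)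
Definition regular_family (s : path_family) : bool :=
  match s with
  | fam_h _ _ E1 E2 => (0%N \notin E1) && (0%N \notin E2)
  | fam_H C1 D1 E1 E2 => admissible C1 D1 E1 E2 && ((0%N \in E2) ==> (0%N \in C1))
  end.

Lemma rule_valueE (A : comNzRingType) (x : A) v s :
  rule_value x v C D E s =
  match s with
  | fam_h C1 D1 E1 E2 =>
      v (fam_H C1 D1 E1 E2) + v (fam_H C1 (with0 D) E1 E2) * v (original C D E)
        * v (fam_H (with0 C) D1 E1 E2)
  | fam_H C1 D1 E1 E2 =>
      if 0%N \in E1 then x * v (fam_H C D1 (prime_set E1) E2)
      else if 0%N \in E2 then x * v (fam_H C1 D E1 (prime_set E2))
      else if 0%N \in C1 then
        if 0%N \in D1 then x ^+ 2 * v (fam_h (prime_set C1) (prime_set D1) E E)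
        else v (fam_H C1 (with0 D1) E1 E2) + v (fam_H C1 D1 E1 (with0 E2))
      else v (fam_H (with0 C1) D1 E E2) + v (fam_H C1 D1 (with0 E1) E2)
        + (0%N \notin D1)%:R
  end.
Proof.
rewrite /rule_value; case: s => C1 D1 E1 E2 /=.
  by rewrite !big_cons !big_nil !expr0 !mul1r !mulr1 addr0 mulrA.
case: ifP => _; first by rewrite !big_cons !big_nil expr1 mulr1 addr0.
case: ifP => _; first by rewrite !big_cons !big_nil expr1 mulr1 addr0.
by case: (0%N \in C1); case: (0%N \in D1) => /=;
  rewrite !big_cons !big_nil ?expr0 ?mul1r ?mulr1 ?addr0 ?addrA.
Qed.

Lemma family_gf_rule s : regular_family s ->
  family_gf C D E s = rule_value fps_x (family_gf C D E) C D E s.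
Proof.
rewrite rule_valueE; case: s => C1 D1 E1 E2 /=.
  by case/andP=> E10 E20; apply: h_gf_split.
case/andP=> /andP[nCE nDE] E2C1; case: ifPn => E10.
  by apply: H_gf_initial_Flat => //; move: nCE; rewrite E10 andbT.
case: ifPn => E20.
  apply: H_gf_final_Flat => //; first by rewrite E20 in E2C1.
  by move: nDE; rewrite E20 andbT.
case: ifPn => C10; last exact: H_gf_initial_split.
case: ifPn => D10; first exact: H_gf_elevated.
exact: H_gf_final_split.
Qed.

Lemma regular_children s t : regular_family s -> t \in children C D E s ->
  regular_family t.
Proof.
case: s => C1 D1 E1 E2; rewrite /children /= /admissible.
  case/andP=> E10 E20; rewrite !inE.
  move=> /or4P[] /eqP-> /=; rewrite /admissible ?E10 ?E20 ?E0 ?(negPf E10) ?(negPf E20) ?andbF //.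
case/andP=> /andP[nCE nDE] E2C1; case: ifPn => E10.
  rewrite inE => /eqP->; rewrite /= /admissible (negPf C0) /= nDE /=.
  (* In Case 1 admissibility gives [0 \notin C1], hence [0 \notin E2], so resetting [C1] to [C]
     keeps the implication true. *)
  by move: E2C1; rewrite E10 andbT in nCE; rewrite (negPf nCE) implybF.
case: ifPn => E20.
  rewrite inE => /eqP->; rewrite /= /admissible (negPf D0) /= (negPf E10) andbF /=.
  by move: E2C1; rewrite E20 /= => ->; rewrite implybT.
case: ifPn => C10; case: ifPn => D10; rewrite /= !inE.
- by move=> ->; rewrite /= E0.
- by move=> /orP[] /eqP->;
    rewrite /= /admissible C10 ?(negPf D10) ?(negPf E10) ?(negPf E20) ?implybT ?andbF.
- by move=> /orP[] /eqP->;
    rewrite /= /admissible ?(negPf C10) ?(negPf E0) ?(negPf E20) ?implybT ?andbF.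
- by move=> /orP[] /eqP->;
    rewrite /= /admissible ?(negPf C10) ?(negPf E0) ?(negPf E20) ?implybT ?andbF.
Qed.

Lemma regular_descendant s : descendant C D E s -> regular_family s.
Proof.
elim=> [|{}s t _ reg_s]; first by rewrite /= E0.
exact: regular_children.
Qed.

(** The rules only add 0, lower elements by one, or restore [C], [D], [E]; so all parameters of
    descendants stay subsets of one initial segment, and such families are finitely many. *)
Definition bounded_family N (s : path_family) : Prop :=
  match s with
  | fam_h C1 D1 E1 E2 | fam_H C1 D1 E1 E2 =>
      [/\ C1 `<=` `I_N, D1 `<=` `I_N, E1 `<=` `I_N & E2 `<=` `I_N]
  end.

Lemma with0_bounded N (S : set nat) : (0 < N)%N -> S `<=` `I_N -> with0 S `<=` `I_N.
Proof. by move=> N0 SN k [/SN|->]. Qed.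

Lemma prime_set_bounded N (S : set nat) : S `<=` `I_N -> prime_set S `<=` `I_N.
Proof. by move=> SN k [n [/SN /= nN _] <-]; apply: leq_ltn_trans (leq_pred n) nN. Qed.

Lemma bounded_children N s t : (0 < N)%N ->
  C `<=` `I_N -> D `<=` `I_N -> E `<=` `I_N ->
  bounded_family N s -> t \in children C D E s -> bounded_family N t.
Proof.
move=> N0 CN DN EN.
have w0 := with0_bounded N0; have pN := @prime_set_bounded N.
case: s => C1 D1 E1 E2 [C1N D1N E1N E2N]; rewrite /children /=.
  by rewrite !inE => /or4P[] /eqP->; split=> //; apply: w0.
case: ifPn => _; first by rewrite inE => /eqP->; split=> //; apply: pN.
case: ifPn => _; first by rewrite inE => /eqP->; split=> //; apply: pN.
case: ifPn => _; case: ifPn => _; rewrite /= !inE.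
- by move=> ->; split=> //; apply: pN.
- by move=> /orP[] /eqP->; split=> //; apply: w0.
- by move=> /orP[] /eqP->; split=> //; apply: w0.
- by move=> /orP[] /eqP->; split=> //; apply: w0.
Qed.

Lemma finite_subsets_II N : finite_set [set S : set nat | S `<=` `I_N].
Proof.
pose f (A : {set 'I_N}) : set nat := [set k | exists2 i : 'I_N, i \in A & val i = k].
apply: (@sub_finite_set _ _ (f @` setT)); last exact/finite_image/finite_finset.
move=> S SN; exists [set i : 'I_N | val i \in S]%SET => //.
apply/seteqP; split=> [k [i]|k Sk]; first by rewrite inE => /set_mem Si <-.
by exists (Ordinal (SN _ Sk)) => //; rewrite inE; apply: mem_set.
Qed.

Lemma finite_bounded_family N : finite_set (bounded_family N).
Proof.
pose B := [set S : set nat | S `<=` `I_N].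
pose f (x : bool * (set nat * set nat * (set nat * set nat))) :=
  let: (b, ((C1, D1), (E1, E2))) := x in
  if b then fam_h C1 D1 E1 E2 else fam_H C1 D1 E1 E2.
have finB : finite_set B := finite_subsets_II N.
apply: (@sub_finite_set _ _ (f @` (setT `*` ((B `*` B) `*` (B `*` B))))).
  case=> C1 D1 E1 E2 [C1N D1N E1N E2N].
    by exists (true, ((C1, D1), (E1, E2))).
  by exists (false, ((C1, D1), (E1, E2))).
apply/finite_image/finite_setX; first exact: finite_finset.
by apply: finite_setX; apply: finite_setX.
Qed.

Lemma finite_descendant : finite_set C -> finite_set D -> finite_set E ->
  finite_set (descendant C D E).
Proof.
move=> finC finD finE.
have bound (S : set nat) : finite_set S -> exists N, forall k, S k -> (k < N)%N.
  move=> /finite_seqP[l ->]; exists (\max_(i <- l) i).+1 => k /= kl.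
  by rewrite ltnS; apply: leq_bigmax_seq.
have [NC CN] := bound _ finC; have [ND DN] := bound _ finD; have [NE EN] := bound _ finE.
(* The sum dominates the three bounds, and the successor makes room for the element 0. *)
pose N := (NC + ND + NE).+1.
have CN' : C `<=` `I_N by move=> k /CN /=; rewrite /N; lia.
have DN' : D `<=` `I_N by move=> k /DN /=; rewrite /N; lia.
have EN' : E `<=` `I_N by move=> k /EN /=; rewrite /N; lia.
apply: sub_finite_set (finite_bounded_family N) => s.
by elim=> [|{}s t _ bs]; [split | apply: bounded_children bs].
Qed.

End Descendants.

(** * Monomials *)

(** Each chosen index is a place where [v] is minimal among all indices from some point on, so later
    choices cannot give a smaller value. *)
Lemma nondecreasing_subsequence (v : nat -> nat) :
  exists2 f : nat -> nat, (forall a b, a < b -> f a < f b)%N &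
    (forall a b, a <= b -> v (f a) <= v (f b))%N.
Proof.
have ming N : exists k, (N <= k)%N /\ forall j, (N <= j -> v k <= v j)%N.
  have exN : exists x, `[< exists2 k, (N <= k)%N & v k = x >].
    by exists (v N); apply/asboolP; exists N.
  case: (ex_minnP exN) => x /asboolP[k Nk <-] min_x; exists k; split=> // j Nj.
  by apply: min_x; apply/asboolP; exists j.
have [g gP] := choice ming.
pose f := fix f k := if k is k'.+1 then g (f k').+1 else g 0%N.
have fS k : (f k < f k.+1)%N by have [] := gP (f k).+1.
have vS k : (v (f k) <= v (f k.+1))%N.
  case: k => [|k]; first by have [_ ->] := gP 0%N.
  have [le_k min_k] := gP (f k).+1.
  apply: min_k; exact: (ltn_trans (fS k) (fS k.+1)).
exists f; first exact: (homo_ltn ltn_trans).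
exact: (homo_leq leqnn leq_trans).
Qed.

(** Subsequences are refined one coordinate at a time: after [k] refinements the first [k]
    coordinates are nondecreasing. *)
Lemma dickson_sequence n (u : nat -> 'X_{1..n}) :
  exists i j, (i < j)%N /\ (u i <= u j)%MM.
Proof.
have step k : (k <= n)%N -> exists2 f : nat -> nat, (forall a b, a < b -> f a < f b)%N &
    forall i : 'I_n, (i < k)%N -> forall a b, (a <= b -> u (f a) i <= u (f b) i)%N.
  elim: k => [|k IHk] lekn; first by exists id.
  have [f f_incr f_le] := IHk (ltnW lekn).
  have [g g_incr g_le] := nondecreasing_subsequence (fun a => u (f a) (Ordinal lekn)).
  have g_mono a b : (a <= b -> g a <= g b)%N.
    by rewrite leq_eqVlt => /orP[/eqP->//|/g_incr/ltnW].
  exists (f \o g) => [a b /g_incr/f_incr//|i]; rewrite ltnS leq_eqVlt.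
  case/orP=> [/eqP ik a b ab|ik a b /g_mono]; last exact: f_le.
  by rewrite (_ : i = Ordinal lekn); [apply: g_le | apply: val_inj].
have [f f_incr f_le] := step n (leqnn n).
exists (f 0%N), (f 1%N); split; first exact: f_incr.
by apply/mnm_lepP => i; apply: f_le.
Qed.

Lemma dickson n (P : set 'X_{1..n}) : exists2 l : seq 'X_{1..n},
  forall m, m \in l -> P m & forall m, P m -> exists2 m', m' \in l & (m' <= m)%MM.
Proof.
apply: contrapT => noB.
(* If no finite list works, every list in [P] misses some element of [P]. The conditional form, with
   default [0%MM], makes the choice total; iterating it yields a sequence that contradicts
   [dickson_sequence]. *)
have next (l : seq 'X_{1..n}) : exists x, (forall m, m \in l -> P m) ->
    P x /\ forall m', m' \in l -> ~~ (m' <= x)%MM.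
  case: (pselect (forall m, m \in l -> P m)) => [lP|nlP]; last by exists 0%MM.
  apply: contrapT => noX; apply: noB; exists l => // m Pm.
  apply: contrapT => noD; apply: noX; exists m => _; split=> // m' m'l.
  by apply/negP => m'm; apply: noD; exists m'.
have [f fP] := choice next.
pose L := fix L k := if k is k'.+1 then f (L k') :: L k' else [::].
have LP k : forall m, m \in L k -> P m.
  elim: k => //= k IHk m; rewrite inE => /orP[/eqP->|/IHk//].
  by have [] := fP _ IHk.
have inL i j : (i < j)%N -> f (L i) \in L j.
  elim: j => // j IHj; rewrite ltnS leq_eqVlt => /orP[/eqP->|/IHj]; rewrite /= inE ?eqxx //.
  by move=> ->; rewrite orbT.
have [i [j [ij]]] := dickson_sequence (f \o L).
by have [_ /(_ _ (inL _ _ ij))/negPf/= ->] := fP _ (LP j).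
Qed.

Section Lex.
Variable n : nat.
Implicit Types m : 'X_{1..n}.

Lemma lex_ltP {m1 m2} : reflect
  (exists2 i : 'I_n, (m1 i < m2 i)%N & forall j : 'I_n, (j < i)%N -> m1 j = m2 j)
  (lex_lt m1 m2).
Proof.
apply: (iffP existsP) => [[i /andP[lt_i /forallP eq_i]]|[i lt_i eq_i]]; exists i => //.
  by move=> j ji; apply/eqP; have /implyP := eq_i j; apply.
by rewrite lt_i; apply/forallP => j; apply/implyP => /eq_i->.
Qed.

Lemma lex_ltxx m : lex_lt m m = false.
Proof. by apply/negbTE/negP => /lex_ltP[i]; rewrite ltnn. Qed.

Lemma lex_lt_trans m2 m1 m3 : lex_lt m1 m2 -> lex_lt m2 m3 -> lex_lt m1 m3.
Proof.
move=> /lex_ltP[i lt_i eq_i] /lex_ltP[j lt_j eq_j]; apply/lex_ltP.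
case: (ltngtP i j) => ij.
- exists i => [|k ki]; first by rewrite -(eq_j _ ij).
  by rewrite eq_i // eq_j // (ltn_trans ki).
- exists j => [|k kj]; first by rewrite (eq_i _ ij).
  by rewrite eq_i ?eq_j // (ltn_trans kj).
- exists i => [|k ki]; last by rewrite eq_i // eq_j // -ij.
  by rewrite (ltn_trans lt_i) // (val_inj ij).
Qed.

Lemma lex_lt_total m1 m2 : m1 != m2 -> lex_lt m1 m2 || lex_lt m2 m1.
Proof.
move=> ne12; have [i0 ne_i0] : exists i, m1 i != m2 i.
  apply/existsP; apply: contraNT ne12; rewrite negb_exists => /forallP eq12.
  by apply/eqP/mnmP => i; apply/eqP; have := eq12 i; rewrite negbK.
case: (@arg_minnP _ i0 [pred i | m1 i != m2 i] val ne_i0) => i /= ne_i min_i.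
have eq_i (j : 'I_n) : (j < i)%N -> m1 j = m2 j.
  by move=> ji; apply/eqP; apply: contraTT ji => /min_i; rewrite -leqNgt.
case: (ltngtP (m1 i) (m2 i)) ne_i => // lt_i _; apply/orP; [left|right];
  by apply/lex_ltP; exists i => // j /eq_i.
Qed.

Lemma lex_lt_add m m1 m2 : lex_lt (m + m1)%MM (m + m2)%MM = lex_lt m1 m2.
Proof.
apply/lex_ltP/lex_ltP => -[i lt_i eq_i]; exists i.
- by move: lt_i; rewrite !mnmDE ltn_add2l.
- by move=> j /eq_i; rewrite !mnmDE => /addnI.
- by rewrite !mnmDE ltn_add2l.
- by move=> j /eq_i; rewrite !mnmDE => ->.
Qed.

Definition lex_le m1 m2 := (m1 == m2) || lex_lt m1 m2.

Lemma lex_le_refl m : lex_le m m. Proof. by rewrite /lex_le eqxx. Qed.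

Lemma lex_le_trans m2 m1 m3 : lex_le m1 m2 -> lex_le m2 m3 -> lex_le m1 m3.
Proof.
case/predU1P=> [->//|lt12] /predU1P[<-|lt23]; rewrite /lex_le ?lt12 ?orbT //.
by rewrite (lex_lt_trans lt12) ?orbT.
Qed.

Lemma lex_leNgt m1 m2 : lex_le m1 m2 = ~~ lex_lt m2 m1.
Proof.
rewrite /lex_le; case: eqVneq => [->|/lex_lt_total]; first by rewrite lex_ltxx.
case: (boolP (lex_lt m1 m2)) => [lt12 _|_ /= ->] //=.
by case: (boolP (lex_lt m2 m1)) => // /(lex_lt_trans lt12); rewrite lex_ltxx.
Qed.

Lemma lex_le_anti m1 m2 : lex_le m1 m2 -> lex_le m2 m1 -> m1 = m2.
Proof. by case/predU1P=> // lt12; rewrite lex_leNgt lt12. Qed.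

Lemma lem_lex_le m1 m2 : (m1 <= m2)%MM -> lex_le m1 m2.
Proof.
move=> /mnm_lepP le12; rewrite lex_leNgt; apply/negP => /lex_ltP[i].
by rewrite ltnNge le12.
Qed.

Lemma lex_max_seq (l : seq 'X_{1..n}) : l != [::] ->
  exists2 m, m \in l & forall m', m' \in l -> lex_le m' m.
Proof.
elim: l => // m l IHl _; case: (eqVneq l [::]) => [->|/IHl[m1 m1l max1]].
  by exists m; rewrite ?inE // => m'; rewrite inE => /eqP->; apply: lex_le_refl.
case: (boolP (lex_le m1 m)) => [le1|]; last first.
  rewrite lex_leNgt negbK => lt1; exists m1; first by rewrite inE m1l orbT.
  by move=> m'; rewrite inE => /predU1P[->|/max1//]; rewrite /lex_le lt1 orbT.
exists m; first by rewrite mem_head.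
move=> m'; rewrite inE => /predU1P[->|/max1 le']; first exact: lex_le_refl.
exact: lex_le_trans le' le1.
Qed.

Lemma lex_min_seq (l : seq 'X_{1..n}) : l != [::] ->
  exists2 m, m \in l & forall m', m' \in l -> lex_le m m'.
Proof.
elim: l => // m l IHl _; case: (eqVneq l [::]) => [->|/IHl[m1 m1l max1]].
  by exists m; rewrite ?inE // => m'; rewrite inE => /eqP->; apply: lex_le_refl.
case: (boolP (lex_le m m1)) => [le1|]; last first.
  rewrite lex_leNgt negbK => lt1; exists m1; first by rewrite inE m1l orbT.
  by move=> m'; rewrite inE => /predU1P[->|/max1//]; rewrite /lex_le lt1 orbT.
exists m; first by rewrite mem_head.
move=> m'; rewrite inE => /predU1P[->|/max1]; first exact: lex_le_refl.
exact: lex_le_trans.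
Qed.

(** The order extends divisibility, so the least element of a finite Dickson basis of [P] is least
    in [P]. *)
Lemma lex_well_founded (P : set 'X_{1..n}) m0 : P m0 ->
  exists2 m, P m & forall m', P m' -> lex_le m m'.
Proof.
move=> Pm0; have [l lP l_div] := dickson P.
have [|m ml min_m] := @lex_min_seq l.
  by have [m' m'l _] := l_div _ Pm0; apply/eqP => l0; rewrite l0 in m'l.
exists m; first exact: lP.
move=> m' /l_div[m1 m1l /lem_lex_le]; apply: lex_le_trans; exact: min_m.
Qed.

Implicit Types p q g : {mpoly Qx[n]}.

Lemma lead_mon_ge p m : m \in msupp p -> lex_le m (lead_mon p).
Proof.
have maxl m1 m2 : lex_le m1 (lex_max m1 m2) /\ lex_le m2 (lex_max m1 m2).
  rewrite /lex_max; case: ifPn; rewrite -?lex_leNgt => le12; split=> //;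
  by rewrite ?lex_le_refl // /lex_le le12 orbT.
rewrite /lead_mon; elim: (msupp p) => // m1 l IHl.
rewrite inE big_cons; have [le1 le2] := maxl m1 (\big[@lex_max n/0%MM]_(m <- l) m).
by case/predU1P=> [->//|/IHl le_m]; apply: lex_le_trans le_m le2.
Qed.

Lemma lead_mon_supp p : p != 0 -> lead_mon p \in msupp p.
Proof.
have le0 m : lex_le 0%MM m.
  by apply: lem_lex_le; apply/mnm_lepP => i; rewrite mnm0E.
rewrite -msupp_eq0 /lead_mon; elim: (msupp p) => // m1 l IHl _.
rewrite big_cons; case: (eqVneq l [::]) => [->|/IHl ml].
  rewrite big_nil /lex_max; case: ifP; last by rewrite inE eqxx.
  by move=> lt0; have := le0 m1; rewrite lex_leNgt lt0.
by rewrite /lex_max; case: ifP => _; rewrite inE ?eqxx // ml orbT.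
Qed.

Lemma lead_mon_eq p m : m \in msupp p ->
  (forall m', m' \in msupp p -> lex_le m' m) -> lead_mon p = m.
Proof.
move=> mp max_m; have p0 : p != 0.
  by apply/eqP => p0; rewrite p0 msupp0 in mp.
by apply: lex_le_anti; [apply/max_m/lead_mon_supp | apply: lead_mon_ge].
Qed.

Lemma lead_coef_neq0 p : p != 0 -> p@_(lead_mon p) != 0.
Proof. by move=> /lead_mon_supp; rewrite mcoeff_msupp. Qed.

Lemma mem_msuppMX p m m' :
  (m' \in msupp (p * 'X_[m])) <-> exists2 m1, m1 \in msupp p & m' = (m + m1)%MM.
Proof.
by rewrite (perm_mem (msuppMX p m)); split=> [/mapP|/mapP].
Qed.

Lemma lead_monMX p m : p != 0 -> lead_mon (p * 'X_[m]) = (m + lead_mon p)%MM.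
Proof.
move=> p0; apply: lead_mon_eq => [|m'].
  by apply/mem_msuppMX; exists (lead_mon p) => //; apply: lead_mon_supp.
case/mem_msuppMX=> m1 /lead_mon_ge; rewrite /lex_le => /predU1P[-> ->|lt1 ->].
  by rewrite eqxx.
by rewrite lex_lt_add lt1 orbT.
Qed.

Lemma divides_lead_term g p : p != 0 -> divides (lead_term g) (lead_term p) ->
  g != 0 /\ (lead_mon g <= lead_mon p)%MM.
Proof.
move=> p0 [c]; rewrite /lead_term -scalerAr => eq_p.
have : lead_mon p \in msupp (p@_(lead_mon p) *: 'X_[lead_mon p]).
  by rewrite msuppMCX ?inE // lead_coef_neq0.
rewrite eq_p => in_p; split.
  by apply/eqP => g0; rewrite g0 mcoeff0 scale0r msupp0 in in_p.
have /mem_msuppMX[m1 _ ->] := msuppZ_le in_p; exact: lem_addr.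
Qed.

Lemma lead_term_divides g p : g != 0 -> (lead_mon g <= lead_mon p)%MM ->
  divides (lead_term g) (lead_term p).
Proof.
move=> g0 le_gp; rewrite /divides /lead_term.
exists ((p@_(lead_mon p) / g@_(lead_mon g)) *: 'X_[lead_mon p - lead_mon g]).
rewrite -scalerAl -scalerAr scalerA divfK ?lead_coef_neq0 //.
by rewrite -mpolyXD submK.
Qed.

End Lex.

(** * Groebner bases *)

Section IdealGen.
Variables (A : comNzRingType) (B : set A).

Lemma ideal_genD p q : ideal_gen B p -> ideal_gen B q -> ideal_gen B (p + q).
Proof.
move=> [l [lB ->]] [l' [lB' ->]]; exists (l ++ l'); rewrite big_cat; split=> // t.
by rewrite mem_cat => /orP[/lB|/lB'].
Qed.

Lemma ideal_genM a p : ideal_gen B p -> ideal_gen B (a * p).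
Proof.
move=> [l [lB ->]]; exists [seq (a * t.1, t.2) | t <- l]; split.
  by move=> _ /mapP[t /lB Bt ->].
by rewrite big_map mulr_sumr; apply: eq_bigr => t _; rewrite mulrA.
Qed.

Lemma ideal_genB p q : ideal_gen B p -> ideal_gen B q -> ideal_gen B (p - q).
Proof. by move=> Bp Bq; rewrite -mulN1r; apply/ideal_genD/ideal_genM. Qed.

End IdealGen.

(** Some summand must contribute to the coefficient of ['X_[m]], and the monomials of a multiple of
    a leading term are multiples of that leading monomial. *)
Lemma ideal_gen_monomial n (B : set {mpoly Qx[n]}) m :
  ideal_gen [set t | exists2 g, B g & t = lead_term g] 'X_[m] ->
  exists g, [/\ B g, g != 0 & (lead_mon g <= m)%MM].
Proof.
move=> [l [lB eqX]]; apply: contrapT => noB.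
have : (\sum_(t <- l) t.1 * t.2)@_m = 0.
  rewrite raddf_sum /= big_seq big1 // => t /lB[g Bg ->].
  apply/eqP; rewrite mcoeff_eq0 /lead_term -scalerAr; apply/negP => in_g.
  have [g0|g0] := eqVneq g 0.
    by rewrite g0 mcoeff0 scale0r msupp0 in in_g.
  have /mem_msuppMX[m1 _ eqm] := msuppZ_le in_g.
  by apply: noB; exists g; split=> //; rewrite eqm lem_addr.
by rewrite -eqX mcoeffX eqxx => /eqP; rewrite oner_eq0.
Qed.

Section Groebner.
Variables (n : nat) (B : set {mpoly Qx[n]}).
Let I := ideal_gen B.

Let LM : set 'X_{1..n} := [set m | exists2 p, I p & p != 0 /\ lead_mon p = m].

Lemma lead_mons_up m m' : LM m -> (m <= m')%MM -> LM m'.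
Proof.
move=> [p Ip [p0 lp]] le_m; exists ('X_[m' - m] * p); first exact: ideal_genM.
rewrite mulrC lead_monMX // lp submK //; split=> //.
by rewrite mulf_neq0 // -msupp_eq0 msuppX.
Qed.

Lemma minimal_lead_mon m : LM m -> exists m', [/\ LM m', (m' <= m)%MM &
  forall m1, LM m1 -> (m1 <= m')%MM -> m1 = m'].
Proof.
move=> LMm.
have [m' [LMm' le_m] min_m] :=
  @lex_well_founded _ [set m' | LM m' /\ (m' <= m)%MM] m (conj LMm (lepm_refl m)).
exists m'; split=> // m1 LM1 le1; apply: lex_le_anti; first exact: lem_lex_le.
by apply: min_m; split=> //; apply: lepm_trans le_m.
Qed.

(** The minimal generators, for divisibility, of the monomial ideal of leading monomials; they index
    the reduced basis constructed below. *)
Definition minimal_mon m := LM m /\ forall m1, LM m1 -> (m1 <= m)%MM -> m1 = m.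

Lemma finite_minimal_mon : exists l : seq 'X_{1..n}, forall m, m \in l <-> minimal_mon m.
Proof.
have [l lL l_div] := dickson LM.
exists [seq m <- l | `[< minimal_mon m >]] => m; rewrite mem_filter; split.
  by case/andP=> /asboolP.
move=> min_m; rewrite (asboolT min_m) /=; have [LMm minm] := min_m.
by have [m' m'l le_m] := l_div _ LMm; rewrite -(minm _ (lL _ m'l) le_m).
Qed.

(* The tail is reduced by cancelling the largest monomial that some leading
   monomial divides, which terminates as the lexicographic order is well-founded. *)
Lemma reduced_element m : LM m -> exists g, [/\ I g, g != 0, lead_mon g = m &
  forall m', m' \in msupp g -> m' != m -> ~ LM m'].
Proof.
move=> [p Ip [p0 lp]]; apply: contrapT => no_g.
pose good (g : {mpoly Qx[n]}) := [/\ I g, g != 0 & lead_mon g = m].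
pose bad (g : {mpoly Qx[n]}) := [seq m' <- msupp g | (m' != m) && `[< LM m' >]].
pose P := [set b | exists2 g, good g & b \in bad g /\ forall b', b' \in bad g -> lex_le b' b].
have badP g : good g -> exists b, b \in bad g /\ forall b', b' \in bad g -> lex_le b' b.
  move=> [Ig g0 lg]; case: (eqVneq (bad g) [::]) => [bad0|/lex_max_seq[b bg maxb]].
    case: no_g; exists g; split=> // m' m'g ne_m' LMm'.
    suff : m' \in bad g by rewrite bad0.
    by rewrite mem_filter ne_m' m'g andbT; apply/asboolP.
  by exists b.
have [b0 b0P] := badP p (And3 Ip p0 lp).
have [b [g [Ig g0 lg] [bg maxb]] minb] :=
  @lex_well_founded _ P b0 (ex_intro2 _ _ p (And3 Ip p0 lp) b0P).
move: (bg); rewrite mem_filter => /andP[/andP[ne_b /asboolP LMb] b_g].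
have [h Ih [h0 lh]] := LMb.
have lt_bm : lex_lt b m.
  by move: (lead_mon_ge b_g); rewrite lg /lex_le (negPf ne_b).
have [c eqc] : exists c, c = g@_b / h@_b by eexists.
have [g' eqg'] : exists g', g' = g - c *: h by eexists.
have hb0 : h@_b != 0 by rewrite -lh lead_coef_neq0.
have h_gt m' : lex_lt b m' -> h@_m' = 0.
  move=> lt_b; apply/eqP; rewrite mcoeff_eq0; apply/negP => /lead_mon_ge.
  by rewrite lh lex_leNgt lt_b.
(* Cancelling at [b] changes nothing above [b]: the leading monomial [m] survives, and a bad
   monomial of [g'] above [b] would already be bad in [g]. *)
have g'_gt m' : lex_lt b m' -> g'@_m' = g@_m'.
  by move=> /h_gt h0'; rewrite eqg' mcoeffB mcoeffZ h0' mulr0 subr0.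
have g'b : g'@_b = 0 by rewrite eqg' mcoeffB mcoeffZ eqc divfK // subrr.
have supp_g' m' : lex_lt b m' -> (m' \in msupp g') = (m' \in msupp g).
  by move=> /g'_gt eq_m'; rewrite !mcoeff_msupp eq_m'.
have m_g : m \in msupp g by rewrite -lg lead_mon_supp.
have m_g' : m \in msupp g' by rewrite supp_g'.
have good_g' : good g'.
  split; first by by rewrite eqg' -mul_mpolyC; apply: ideal_genB => //; apply: ideal_genM.
    by apply/eqP => g'0; rewrite g'0 msupp0 in m_g'.
  apply: lead_mon_eq => // m' m'g'; rewrite lex_leNgt; apply/negP => lt_m.
  have /lead_mon_ge : m' \in msupp g.
    by rewrite -supp_g' ?(lex_lt_trans lt_bm).
  by rewrite lg lex_leNgt lt_m.
have [b' [b'g' maxb']] := badP _ good_g'.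
have /minb : P b' by exists g'.
move: b'g'; rewrite mem_filter => /andP[bad_b' b'_g'].
rewrite /lex_le => /predU1P[eqb|lt_b].
  by move: b'_g'; rewrite -eqb mcoeff_msupp g'b eqxx.
suff /maxb : b' \in bad g by rewrite lex_leNgt lt_b.
by rewrite mem_filter bad_b' -supp_g'.
Qed.

(** One tail-reduced element for each minimal leading monomial. If another leading monomial divided
    a monomial of [f m], that monomial would be either [m], against minimality, or in the tail,
    against its reduction. *)
Lemma exists_reduced_groebner_basis : exists G, reduced_groebner_basis I G.
Proof.
have [l lP] := finite_minimal_mon.
have red m : exists g, minimal_mon m -> [/\ I g, g != 0, lead_mon g = m &
  forall m', m' \in msupp g -> m' != m -> ~ LM m'].
  case: (pselect (minimal_mon m)) => [[LMm _]|]; last by exists 0.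
  by have [g gP] := reduced_element LMm; exists g.
have [f fP] := choice red.
exists [seq f m | m <- l]; split; [split|].
- by move=> _ /mapP[m /lP/fP[If _ _ _] ->].
- move=> p Ip p0; have LMp : LM (lead_mon p) by exists p.
  have [m [LMm le_m min_m]] := minimal_lead_mon LMp.
  have min_mon : minimal_mon m by [].
  have [_ f0 lf _] := fP _ min_mon; exists (f m); first by apply/map_f/lP.
  by apply: lead_term_divides => //; rewrite lf.
- move=> _ /mapP[m /lP min_m ->] m' m'f.
  have [_ f0 lf redf] := fP _ min_m.
  move=> /ideal_gen_monomial[_ [/andP[/mapP[m1 /lP min1 ->] ne_f] f10]].
  have [If1 _ lf1 _] := fP _ min1; rewrite lf1 => le1.
  have LMm' : LM m' by apply: lead_mons_up le1; case: min1.
  case: (eqVneq m' m) => [eqm|ne_m]; last exact: redf m'f ne_m LMm'.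
  case: min_m => _ /(_ m1); rewrite -eqm => /(_ _ le1) eq1.
  by case/eqP: ne_f; congr f; rewrite eq1 ?eqm //; case: min1.
Qed.

End Groebner.

Lemma exists_smallest_element n (G : seq {mpoly Qx[n]}) g :
  g \in G -> g != 0 -> exists q, smallest_element G q.
Proof.
move=> gG g0; pose L := [seq lead_mon h | h <- G & h != 0].
have [|m /mapP[q]] := @lex_min_seq n L.
  apply/eqP => L0; suff : lead_mon g \in L by rewrite L0.
  by apply: map_f; rewrite mem_filter g0.
rewrite mem_filter => /andP[q0 qG] -> min_q; exists q; split=> // h hG h0.
by rewrite -lex_leNgt; apply: min_q; apply: map_f; rewrite mem_filter h0.
Qed.

(** The last variable is the least one: in pure lexicographic order, a monomial below a power of it
    is again a power of it. *)
Lemma only_last_var_lex_le n (p q : {mpoly Qx[n.+1]}) :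
  only_last_var p -> p != 0 -> lex_le (lead_mon q) (lead_mon p) -> only_last_var q.
Proof.
move=> last_p p0 le_qp.
have lex_last m1 m2 : lex_le m1 m2 -> (forall i : 'I_n.+1, i != ord_max -> m2 i = 0%N) ->
    forall i : 'I_n.+1, i != ord_max -> m1 i = 0%N.
  case/predU1P=> [->//|/lex_ltP[i lt_i eq_i] last2 j nj].
  have ei : i = ord_max by apply: contraTeq lt_i => /last2->.
  rewrite eq_i ?last2 // ei ltn_neqAle -ltnS ltn_ord andbT; exact: nj.
move=> m /lead_mon_ge le_m; apply: lex_last (lex_le_trans le_m le_qp) _.
exact/last_p/lead_mon_supp.
Qed.

Lemma smallest_element_only_last_var n (I : set {mpoly Qx[n.+1]}) G q p :
  groebner_basis I G -> elimination_ideal_last I p -> p != 0 ->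
  smallest_element G q -> only_last_var q.
Proof.
move=> [_ gbG] [Ip last_p] p0 [qG q0 min_q].
have [g gG /(divides_lead_term p0)[g0 le_gp]] := gbG _ Ip p0.
apply: (only_last_var_lex_le last_p p0).
apply: (@lex_le_trans _ (lead_mon g)); last exact: lem_lex_le.
by rewrite lex_leNgt; apply: min_q.
Qed.

(** * Zeros and factors in Q[x][P] *)

Lemma fps_mulf_eq0 (f g : fps) : f * g = 0 -> f = 0 \/ g = 0.
Proof.
have coef_min (h : fps) : h <> 0 -> exists i, fps_coef h i != 0 /\
    forall j, (j < i)%N -> fps_coef h j = 0.
  move=> h0; have exi : exists i, fps_coef h i != 0.
    apply: contrapT => no_i; apply: h0; apply: fpsP => i; rewrite /= coef0.
    by apply: contrapT => /eqP hi; apply: no_i; exists i.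
  case: (ex_minnP exi) => i hi min_i; exists i; split=> // j ji.
  by apply/eqP; apply: contraTT ji => /min_i; rewrite -leqNgt.
move=> fg0; apply: contrapT => /not_orP[/coef_min[i [fi fmin]] /coef_min[j [gj gmin]]].
have := congr1 (fun h => fps_coef h (i + j)) fg0; rewrite /= coef0.
have lt_i : (i < (i + j).+1)%N by rewrite ltnS leq_addr.
rewrite (bigD1 (Ordinal lt_i)) //= addKn big1 => [|[k lt_k]].
  by rewrite addr0 => /eqP; rewrite mulf_eq0 (negPf fi) (negPf gj).
rewrite -val_eqE /=; case: ltngtP => // [/fmin->|gt_k] _; first by rewrite mul0r.
by rewrite gmin ?mulr0 //; lia.
Qed.

Lemma poly_fps_eq0 (p : {poly rat}) : poly_fps p = 0 -> p = 0.
Proof.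
move=> p0; apply/polyP => i.
by have := congr1 (fun h => fps_coef h i) p0; rewrite /= !coef0.
Qed.

Lemma eval_fpsM F G f : eval_fps (F * G) f = eval_fps F f * eval_fps G f.
Proof. by rewrite /eval_fps rmorphM hornerM. Qed.

Lemma eval_fpsD F G f : eval_fps (F + G) f = eval_fps F f + eval_fps G f.
Proof. by rewrite /eval_fps rmorphD hornerD. Qed.

Lemma eval_fpsC c f : eval_fps c%:P f = poly_fps c.
Proof. by rewrite /eval_fps map_polyC hornerC. Qed.

Lemma eval_fpsX f : eval_fps 'X f = f.
Proof. by rewrite /eval_fps map_polyX hornerX. Qed.

Lemma eval_fps0 f : eval_fps 0 f = 0.
Proof. by rewrite eval_fpsC rmorph0. Qed.

Lemma eval_fps1 f : eval_fps 1 f = 1.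
Proof. by rewrite eval_fpsC rmorph1. Qed.

Lemma eval_fpsZ c F f : eval_fps (c *: F) f = poly_fps c * eval_fps F f.
Proof. by rewrite -mul_polyC eval_fpsM eval_fpsC. Qed.

Lemma eval_fps_scale_eq0 c F f : c != 0 -> eval_fps (c *: F) f = 0 -> eval_fps F f = 0.
Proof.
move=> c0; rewrite eval_fpsZ => /fps_mulf_eq0[/poly_fps_eq0 c00|//].
by rewrite c00 eqxx in c0.
Qed.

Lemma eval_fps_unit (F : {poly {poly rat}}) f : F \is a GRing.unit -> eval_fps F f <> 0.
Proof.
move=> uF F0; have /eqP := congr1 (fun G => eval_fps G f) (mulVr uF).
rewrite eval_fpsM F0 mulr0 eval_fps1 => /eqP/esym/eqP.
by rewrite oner_eq0.
Qed.

Lemma eval_fps_trunc F f m t : (t < m)%N ->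
  fps_coef (eval_fps F f) t = (F.[fps_trunc m f])`_t.
Proof.
elim/poly_ind: F t => [|F c IHF] t tm; first by rewrite eval_fps0 horner0 /= coef0.
rewrite eval_fpsD eval_fpsM eval_fpsX eval_fpsC hornerMXaddC coefD coefM /=.
congr (_ + _); apply: eq_bigr => i _.
have le_it : (i <= t)%N by rewrite -ltnS.
rewrite IHF ?(leq_ltn_trans le_it) // coef_poly.
by rewrite (leq_ltn_trans (leq_subr _ _) tm).
Qed.

Section Gauss.
Variable F : fieldType.
Implicit Types (c p : {poly F}) (a b : {poly {poly F}}).

Lemma exists_irreducible_divisor c : c != 0 -> size c != 1%N ->
  exists2 p, irreducible_poly p & p %| c.
Proof.
have [k] := ubnP (size c); elim: k c => // k IHk c; rewrite ltnS => le_ck c0 c1.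
case: (pselect (irreducible_poly c)) => [|nirr]; first by exists c.
have [d [d1 dc ndc]] : exists d : {poly F}, [/\ size d != 1%N, d %| c & ~~ (d %= c)].
  apply: contrapT => nod; apply: nirr; split.
    by rewrite ltn_neqAle eq_sym c1 size_poly_gt0.
  by move=> d d1 dc; apply: contrapT => /negP ndc; apply: nod; exists d.
have d0 : d != 0 by apply: contraNneq c0 => d0; rewrite d0 dvd0p in dc.
have lt_dc : (size d < size c)%N.
  rewrite ltn_neqAle dvdp_leq // andbT; apply: contra ndc => eqs.
  by rewrite -(dvdp_size_eqp dc).
have [p irr_p pd] := IHk d (leq_trans lt_dc le_ck) d0 d1.
by exists p => //; apply: dvdp_trans dc.
Qed.

Lemma irreducible_dvd_mul p c (d : {poly F}) : irreducible_poly p -> p %| c * d -> p %| c \/ p %| d.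
Proof.
move=> [_ irr_p] pcd; have [cop|ncop] := boolP (coprimep p c).
  by right; rewrite Gauss_dvdpr in pcd.
left; apply: dvdp_trans (dvdp_gcdr p c).
have /irr_p : size (gcdp p c) != 1%N by [].
by rewrite dvdp_gcdl => /(_ isT); rewrite /eqp => /andP[].
Qed.

Definition dvd_coefs p a := forall i, p %| a`_i.

Lemma dvd_coefsP p a : dvd_coefs p a -> exists a', a = p *: a'.
Proof.
move=> pa; exists (\poly_(i < size a) (a`_i %/ p)).
apply/polyP => i; rewrite coefZ coef_poly; case: ltnP => [_|le_i].
  by rewrite mulrC divpK.
by rewrite mulr0 nth_default.
Qed.

(** Take the first coefficients of [a] and [b], at [i] and [j], not divisible by [p]: in the
    coefficient of the product at [i + j], all other terms are divisible by [p]. *)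
Lemma gauss_dvd_coefs p a b : irreducible_poly p ->
  dvd_coefs p (a * b) -> dvd_coefs p a \/ dvd_coefs p b.
Proof.
move=> irr_p pab; apply: contrapT => /not_orP[npa npb].
have minc (d : {poly {poly F}}) : ~ dvd_coefs p d -> exists i, ~~ (p %| d`_i) /\
    forall j, (j < i)%N -> p %| d`_j.
  move=> npd; have exi : exists i, ~~ (p %| d`_i).
    apply: contrapT => no_i; apply: npd => i.
    by apply: contrapT => /negP pi; apply: no_i; exists i.
  case: (ex_minnP exi) => i ndi min_i; exists i; split=> // j ji.
  by apply: contraTT ji => /min_i; rewrite -leqNgt.
have [i [nai ai]] := minc _ npa; have [j [nbj bj]] := minc _ npb.
have lt_i : (i < (i + j).+1)%N by rewrite ltnS leq_addr.
have := pab (i + j)%N; rewrite coefM (bigD1 (Ordinal lt_i)) //= addKn.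
rewrite dvdp_addl.
  by case/(irreducible_dvd_mul irr_p) => ?; [case/negP: nai | case/negP: nbj].
apply: (big_ind (fun x => p %| x)) => [|x y px py|[k lt_k]]; first exact: dvdp0.
  by rewrite dvdp_add.
rewrite -val_eqE /=; case: ltngtP => // [/ai pa|gt_k] _; first exact: dvdp_mulr.
by apply: dvdp_mull; apply: bj; lia.
Qed.

(** Gauss's lemma as needed for factorizations: the irreducible factors of the scalar [c] are
    removed one by one, each from whichever of [a] and [b] it divides. *)
Lemma gauss_split c a b d : c != 0 -> d != 0 -> c *: d = a * b ->
  exists s t a' b', [/\ d = a' * b', a = s *: a', b = t *: b', s != 0 & t != 0].
Proof.
have [k] := ubnP (size c); elim: k c a b => // k IHk c a b; rewrite ltnS => le_ck c0 d0.
case: (eqVneq (size c) 1%N) => [/eqP/size_poly1P[r r0 ->]|c1] eq_ab.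
  (* A nonzero constant [c] is a unit and is simply absorbed into [a]. *)
  exists r%:P, 1, (r^-1%:P *: a), b; rewrite scalerA -polyCM mulfV // !scale1r.
  split=> //; rewrite ?polyC_eq0 ?oner_eq0 //.
  by rewrite -scalerAl -eq_ab scalerA -polyCM mulVf // scale1r.
have [p irr_p pc] := exists_irreducible_divisor c0 c1.
have p0 : p != 0 by apply: contraNneq c0 => p0; rewrite p0 dvd0p in pc.
have [c' eqc] : exists c', c = p * c' by exists (c %/ p); rewrite mulrC divpK.
have c'0 : c' != 0 by apply: contraNneq c0 => c'0; rewrite eqc c'0 mulr0.
have lt_c' : (size c' < k)%N.
  apply: leq_trans le_ck; rewrite eqc size_mul //.
  by case: irr_p => p1 _; case: (size p) p1 => [|[|n]] //= _; rewrite addSn ltnS leq_addl.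
have : dvd_coefs p (a * b) by move=> i; rewrite -eq_ab coefZ dvdp_mulr.
have cancel (x y : {poly {poly F}}) : p *: x = p *: y -> x = y.
  by rewrite -!mul_polyC; apply: mulfI; rewrite polyC_eq0.
case/(gauss_dvd_coefs irr_p) => /dvd_coefsP[e eqe].
  have /(IHk c' e b lt_c' c'0 d0)[s [t [a' [b' [eqd eqa' eqb' s0 t0]]]]] : c' *: d = e * b.
    by apply: cancel; rewrite scalerA -eqc eq_ab eqe scalerAl.
  by exists (p * s), t, a', b'; rewrite -scalerA -eqa' mulf_neq0.
have /(IHk c' a e lt_c' c'0 d0)[s [t [a' [b' [eqd eqa' eqb' s0 t0]]]]] : c' *: d = a * e.
  by apply: cancel; rewrite scalerA -eqc eq_ab eqe scalerAr.
by exists s, (p * t), a', b'; rewrite -scalerA -eqb' mulf_neq0.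
Qed.

End Gauss.

(** * Complete factorizations up to associates *)

Section Associates.
Variable A : idomainType.
Implicit Types a b c : A.

Lemma associated_refl a : associated a a.
Proof. by exists 1; rewrite ?unitr1 ?mul1r. Qed.

Lemma associated_sym a b : associated a b -> associated b a.
Proof. by move=> [u uu ->]; exists u^-1; rewrite ?unitrV // mulKr. Qed.

Lemma associated_trans b a c : associated a b -> associated b c -> associated a c.
Proof. by move=> [u uu ->] [v vu ->]; exists (u * v); rewrite ?unitrM ?uu // mulrA. Qed.

Lemma associatedM a b a' b' :
  associated a a' -> associated b b' -> associated (a * b) (a' * b').
Proof.
by move=> [u uu ->] [v vu ->]; exists (u * v); rewrite ?unitrM ?uu // mulrACA.
Qed.

Lemma associated_irreducible a b :
  is_irreducible a -> associated a b -> is_irreducible b.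
Proof.
move=> [a0 nua irr_a] [u uu eqa]; split.
- by apply: contraNneq a0 => b0; rewrite eqa b0 mulr0.
- by apply: contra nua => ub; rewrite eqa unitrM uu.
- move=> c d eqb; have := irr_a (u * c) d; rewrite eqa eqb mulrA.
  by case=> // [|ud]; [rewrite unitrM uu => uc; left | right].
Qed.

(** A factor associated to an earlier one raises its exponent; otherwise it becomes a new factor at
    index [ord0]. This keeps the list pairwise non-associated. *)
Lemma complete_factorization_cons p (Q : A) k (q : 'I_k -> A) (d : 'I_k -> nat) :
  is_irreducible p -> complete_factorization Q q d ->
  exists k' (q' : 'I_k' -> A) (d' : 'I_k' -> nat), complete_factorization (p * Q) q' d'.
Proof.
move=> irr_p [irr_q nassoc d_gt0 facQ].
case: (pselect (exists i, associated p (q i))) => [[i pqi]|npq].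
  exists k, q, (fun j => d j + (j == i))%N; split=> // [j|].
    by rewrite (leq_trans (d_gt0 j)) ?leq_addr.
  apply: associated_trans (associatedM pqi facQ) _.
  under [X in associated _ X]eq_bigr do rewrite exprD.
  rewrite big_split /= [X in associated _ (_ * X)](bigD1 i) //= eqxx expr1.
  rewrite [X in associated _ (_ * (_ * X))]big1 => [|j /negPf->//].
  by rewrite mulr1 mulrC; apply: associated_refl.
exists k.+1, (fun j => oapp q p (unlift ord0 j)), (fun j => oapp d 1%N (unlift ord0 j)).
split.
- by move=> j; case: (unliftP ord0 j) => [j' _|_] /=.
- move=> i j; case: (unliftP ord0 i) => [i'|] ->; case: (unliftP ord0 j) => [j'|] -> //=.
  + by move=> ne_ij; apply: nassoc; apply: contraNneq ne_ij => ->.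
  + by move=> _ /associated_sym qp; apply: npq; exists i'.
  + by move=> _ pq; apply: npq; exists j'.
- by move=> j; case: (unliftP ord0 j) => [j' _|_] /=.
- rewrite big_ord_recl unlift_none /= expr1.
  under [X in associated _ (_ * X)]eq_bigr do rewrite liftK /=.
  exact: associatedM (associated_refl _) facQ.
Qed.

End Associates.

Section BivariateFactorization.
Variable F : fieldType.
Implicit Types P Q : {poly {poly F}}.

(** Not the usual total degree: the degree in [P] plus the degree in [x] of the leading coefficient.
    This quantity is additive on products and, among nonzero polynomials, is 0 only at units, so it
    measures progress in factoring. *)
Definition total_degree Q := ((size Q).-1 + (size (lead_coef Q)).-1)%N.

Lemma total_degreeM P Q : P != 0 -> Q != 0 ->
  total_degree (P * Q) = (total_degree P + total_degree Q)%N.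
Proof.
move=> P0 Q0; rewrite /total_degree lead_coefM !size_mul ?lead_coef_eq0 //.
have := size_poly_gt0 P; have := size_poly_gt0 Q.
have := size_poly_gt0 (lead_coef P); have := size_poly_gt0 (lead_coef Q).
rewrite !lead_coef_eq0 P0 Q0; case: (size P) (size Q) => [|a] [|b] //.
case: (size (lead_coef P)) (size (lead_coef Q)) => [|c] [|d] // _ _ _ _.
by rewrite !addnS /= !addnA [(a + b + c)%N]addnAC.
Qed.

Lemma total_degree_eq0 Q : Q != 0 -> total_degree Q = 0%N -> Q \is a GRing.unit.
Proof.
move=> Q0; rewrite /total_degree => /eqP; rewrite addn_eq0 => /andP[szQ szl].
have /size_poly1P[c c0 eqQ] : size Q == 1%N.
  by rewrite eqn_leq size_poly_gt0 Q0 andbT -subn_eq0 subn1.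
rewrite eqQ lead_coefC in szl.
have /size_poly1P[r r0 eqc] : size c == 1%N.
  by rewrite eqn_leq size_poly_gt0 c0 andbT -subn_eq0 subn1.
apply/unitrPr; exists r^-1%:P%:P.
by rewrite eqQ eqc -!polyCM mulfV.
Qed.

Lemma exists_complete_factorization Q : Q != 0 ->
  exists k (q : 'I_k -> {poly {poly F}}) (d : 'I_k -> nat), complete_factorization Q q d.
Proof.
have fac_list : forall N Q, (total_degree Q < N)%N -> Q != 0 ->
    exists2 l : seq {poly {poly F}}, (forall p, p \in l -> is_irreducible p) &
      associated Q (\prod_(p <- l) p).
  elim=> // N IHN {}Q; rewrite ltnS => le_QN Q0.
  case: (boolP (Q \is a GRing.unit)) => [uQ|nuQ].
    by exists [::] => //; rewrite big_nil; exists Q; rewrite ?mulr1.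
  case: (pselect (is_irreducible Q)) => [irrQ|nirrQ].
    exists [:: Q] => [p|]; first by rewrite inE => /eqP->.
    by rewrite big_seq1; apply: associated_refl.
  have [a [b [eqQ nua nub]]] : exists a b, [/\ Q = a * b,
      a \isn't a GRing.unit & b \isn't a GRing.unit].
    apply: contrapT => no_ab; apply: nirrQ; split=> // a b eqQ.
    apply: contrapT => /not_orP[/negP nua /negP nub].
    by apply: no_ab; exists a, b.
  have a0 : a != 0 by apply: contraNneq Q0 => a0; rewrite eqQ a0 mul0r.
  have b0 : b != 0 by apply: contraNneq Q0 => b0; rewrite eqQ b0 mulr0.
  have deg_gt0 P : P != 0 -> P \isn't a GRing.unit -> (0 < total_degree P)%N.
    by move=> P0; rewrite lt0n; apply: contra => /eqP/(total_degree_eq0 P0).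
  have := deg_gt0 _ a0 nua; have := deg_gt0 _ b0 nub.
  move: le_QN; rewrite eqQ total_degreeM // => le_N gt_b gt_a.
  have lt_a : (total_degree a < N)%N by lia.
  have lt_b : (total_degree b < N)%N by lia.
  have [la la_irr fac_a] := IHN a lt_a a0; have [lb lb_irr fac_b] := IHN b lt_b b0.
  exists (la ++ lb) => [p|]; first by rewrite mem_cat => /orP[/la_irr|/lb_irr].
  by rewrite big_cat; apply: associatedM.
move=> Q0; have [l l_irr fac] := fac_list _ Q (leqnn _) Q0.
suff [k [q [d [irr_q nassoc d_gt0 facl]]]] : exists k (q : 'I_k -> {poly {poly F}})
    (d : 'I_k -> nat), complete_factorization (\prod_(p <- l) p) q d.
  by exists k, q, d; split=> //; apply: associated_trans fac facl.
elim: l l_irr {fac} => [|p l IHl] l_irr.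
  exists 0%N, (fun _ => 1), (fun _ => 1%N); split; try by case.
  by rewrite big_nil big_ord0; apply: associated_refl.
have [|k [q [d fac]]] := IHl; first by move=> p' p'l; apply: l_irr; rewrite inE p'l orbT.
by rewrite big_cons; apply: complete_factorization_cons fac; apply/l_irr/mem_head.
Qed.

End BivariateFactorization.

(* The polynomials vanishing at f are, up to factors in Q[x], the multiples of
   one of least degree in P; by Gauss, such a multiple is a scalar times every
   irreducible polynomial vanishing at f. *)
Lemma irreducible_zero_uniq (f : fps) (p q : {poly {poly rat}}) :
  is_irreducible p -> is_irreducible q -> eval_fps p f = 0 -> eval_fps q f = 0 ->
  associated p q.
Proof.
move=> irr_p irr_q pf qf.
have [g [g0 gf min_g]] : exists g : {poly {poly rat}}, [/\ g != 0, eval_fps g f = 0 &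
    forall h : {poly {poly rat}}, (size h < size g)%N -> eval_fps h f = 0 -> h = 0].
  have ex_size : exists k, `[< exists g : {poly {poly rat}},
      [/\ size g = k, g != 0 & eval_fps g f = 0] >].
    by exists (size p); apply/asboolP; exists p; split=> //; case: irr_p.
  case: (ex_minnP ex_size) => k /asboolP[g [szg g0 gf]] min_k.
  exists g; split=> // h lt_h hf; apply/eqP; apply: contraTT lt_h => h0.
  by rewrite -leqNgt szg; apply: min_k; apply/asboolP; exists h.
have scalar_multiple r : is_irreducible r -> eval_fps r f = 0 ->
    exists s r', [/\ associated r r', g = s *: r', s != 0 & eval_fps r' f = 0].
  move=> [r0 _ irr_r] rf; have := Pdiv.WeakIdomain.divp_eq r g.
  (* Over Q[x] only pseudo-division is possible: [c] is a power of the leading coefficient of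
     [g]. *)
  set c := _ ^+ _; set h := (_ %/ _)%R => eq_div.
  have c0 : c != 0 by rewrite expf_neq0 // lead_coef_eq0.
  have mod0 : r %% g = 0.
    apply: min_g; first by rewrite ltn_modp.
    have := congr1 (fun P => eval_fps P f) eq_div.
    by rewrite eval_fpsZ eval_fpsD eval_fpsM rf gf !mulr0 add0r.
  rewrite mod0 addr0 mulrC in eq_div.
  have [s [t [g' [h' [eqr eqg eqh s0 t0]]]]] := gauss_split c0 r0 eq_div.
  have g'f : eval_fps g' f = 0 by apply: eval_fps_scale_eq0 s0 _; rewrite -eqg.
  exists s, g'; split=> //; exists h'; last by rewrite mulrC.
  by case: (irr_r _ _ eqr) => // /(@eval_fps_unit _ f)/(_ g'f).
have [s [p' [pp' eqg s0 p'f]]] := scalar_multiple p irr_p pf.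
have [t [q' [qq' eqg' t0 q'f]]] := scalar_multiple q irr_q qf.
have [p'0 _ irr_p'] := associated_irreducible irr_p pp'.
have [_ _ irr_q'] := associated_irreducible irr_q qq'.
have eqpq : s *: p' = t%:P * q' by rewrite mul_polyC -eqg -eqg'.
(* Gauss factors [p'] as [a * b] with [q'] a scalar [t'] times [b]. As [b] vanishes at [f] it is not
   a unit, so irreducibility makes both [a] and [t'%:P] units. *)
have [s' [t' [a [b [eqp' _ eqq' _ t'0]]]]] := gauss_split s0 p'0 eqpq.
have bf : eval_fps b f = 0 by apply: eval_fps_scale_eq0 t'0 _; rewrite -eqq'.
have nub : ~ b \is a GRing.unit by move=> /(@eval_fps_unit _ f)/(_ bf).
have ua : a \is a GRing.unit by case: (irr_p' _ _ eqp') => // /nub.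
have ut' : t'%:P \is a GRing.unit.
  by case: (irr_q' t'%:P b); rewrite ?mul_polyC // => /nub.
have p'b : associated p' b by exists a.
have q'b : associated q' b by exists t'%:P; rewrite ?mul_polyC.
apply: associated_trans pp' _; apply: associated_trans p'b _.
by apply: associated_trans (associated_sym q'b) _; apply: associated_sym.
Qed.

(** * Clearing denominators *)

Lemma fraction_denominator (R : idomainType) (a : {fraction R}) :
  exists2 v : R, v != 0 & exists u : R, tofrac v * a = tofrac u.
Proof.
elim/generic_quotient.quotW: a => -[[u v] /= v0]; exists v => //; exists u.
unlock FracField.tofrac; rewrite -[LHS]FracField.pi_mul.
apply/generic_quotient.eqmodP; rewrite /= FracField.equivfE.
rewrite /FracField.mulf /= !numden_Ratio ?mul1r ?oner_neq0 //=.
by rewrite mulr1.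
Qed.

Section ClearDenominators.
Variables (R : idomainType) (n : nat).
Notation K := {fraction R}.

Lemma mpoly_clear_denominators (p : {mpoly K[n]}) :
  exists2 c : R, c != 0 & exists p' : {mpoly R[n]},
    tofrac c *: p = map_mpoly (@tofrac R) p'.
Proof.
rewrite [p]mpolyE; elim: (msupp p) => [|m l [c c0 [p' eqp']]].
  by exists 1; rewrite ?oner_eq0 //; exists 0; rewrite big_nil scaler0 raddf0.
have [v v0 [u equ]] := fraction_denominator p@_m.
exists (v * c); first by rewrite mulf_neq0.
exists ((c * u) *: 'X_[m] + v *: p').
rewrite big_cons scalerDr raddfD /= !map_mpolyZ map_mpolyX -eqp' !rmorphM /=.
by rewrite !scalerA -equ mulrA (mulrC (tofrac c)).
Qed.

Lemma map_tofrac_inj : injective (map_mpoly (@tofrac R) : {mpoly R[n]} -> {mpoly K[n]}).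
Proof.
move=> p q eq_pq; apply/mpolyP => m; apply/eqP; rewrite -tofrac_eq -!mcoeff_map_mpoly.
by rewrite eq_pq.
Qed.

Variables (S : comNzRingType) (phi : {rmorphism R -> S}) (h : 'I_n -> S).

(** [phi] need not extend to the fraction field, so evaluation at [h] makes sense only over [R],
    after multiplication by a common denominator of the coefficients of the combination. *)
Lemma ideal_clear_denominators (B : set {mpoly K[n]}) p :
  (forall b, B b -> exists2 b' : {mpoly R[n]}, b = map_mpoly (@tofrac R) b' &
     mmap phi h b' = 0) ->
  ideal_gen B p ->
  exists2 c : R, c != 0 & exists2 p' : {mpoly R[n]},
    tofrac c *: p = map_mpoly (@tofrac R) p' & mmap phi h p' = 0.
Proof.
move=> B0 [l [lB ->]]; elim: l lB => [|[a b] l IHl] lB.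
  by exists 1; rewrite ?oner_eq0 //; exists 0; rewrite ?raddf0 // big_nil scaler0.
have [|c c0 [p' eqp' p'0]] := IHl; first by move=> t tl; apply: lB; rewrite inE tl orbT.
have [/= b' -> b'0] := B0 _ (lB _ (mem_head _ _)).
have [v v0 [a' eqa']] := mpoly_clear_denominators a.
exists (v * c); first by rewrite mulf_neq0.
exists (c *: (a' * b') + v *: p'); last first.
  by rewrite raddfD /= !mmapZ rmorphM /= b'0 p'0 !mulr0 addr0.
rewrite big_cons scalerDr raddfD /= !map_mpolyZ [map_mpoly _ (a' * b')]rmorphM /=.
rewrite -eqa' -eqp' tofracM.
by rewrite !scalerA -!scalerAl scalerA [tofrac c * _]mulrC.
Qed.

End ClearDenominators.

Lemma rule_value_rmorph (A B : comNzRingType) (phi : {rmorphism A -> B}) x v C D E s :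
  phi (rule_value x v C D E s) = rule_value (phi x) (phi \o v) C D E s.
Proof.
rewrite /rule_value rmorph_sum; apply: eq_bigr => t _.
by rewrite rmorphM rmorphXn rmorph_prod.
Qed.

Lemma eq_rule_value (A : comNzRingType) (x : A) v v' C D E s :
  (forall u, u \in children C D E s -> v u = v' u) ->
  rule_value x v C D E s = rule_value x v' C D E s.
Proof.
move=> eq_v; rewrite /rule_value !big_seq; apply: eq_bigr => t tr.
congr (_ * _); rewrite !big_seq; apply: eq_bigr => u ut; apply: eq_v.
by apply/flattenP; exists t.2 => //; apply: map_f.
Qed.

Section LastVariable.
Variable n : nat.

Definition last_var_mpoly (Q : {poly {poly rat}}) : {mpoly {poly rat}[n.+1]} :=
  (map_poly (@mpolyC n.+1 _) Q).['X_ord_max].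

Lemma in_last_varE Q :
  in_last_var n Q = map_mpoly (@tofrac {poly rat}) (last_var_mpoly Q).
Proof.
rewrite /last_var_mpoly -horner_map /= map_mpolyX -map_poly_comp.
by congr (_.[_]); apply: eq_map_poly => c /=; rewrite map_mpolyC.
Qed.

Lemma mmap_last_var_mpoly (h : 'I_n.+1 -> fps) Q :
  mmap poly_fps h (last_var_mpoly Q) = eval_fps Q (h ord_max).
Proof.
rewrite /last_var_mpoly -horner_map /= mmapX mmap1U -map_poly_comp.
by congr (_.[_]); apply: eq_map_poly => c /=; rewrite mmapC.
Qed.

Lemma in_last_varZ c Q : in_last_var n (c *: Q) = tofrac c *: in_last_var n Q.
Proof.
rewrite !in_last_varE -map_mpolyZ; congr map_mpoly.
by rewrite /last_var_mpoly map_polyZ hornerZ /= mul_mpolyC.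
Qed.

Lemma last_var_mpoly_sum (p : {mpoly {poly rat}[n.+1]}) :
  (forall m, m \in msupp p -> forall i : 'I_n.+1, i != ord_max -> m i = 0%N) ->
  p = last_var_mpoly (\sum_(m <- msupp p) p@_m *: 'X^(m ord_max)).
Proof.
move=> last_p; rewrite /last_var_mpoly rmorph_sum horner_sum {1}[p]mpolyE !big_seq.
apply: eq_bigr => m /last_p last_m.
rewrite /= map_polyZ map_polyXn hornerZ hornerXn mul_mpolyC; congr (_ *: _).
rewrite mpolyXE_id (bigD1 ord_max) //= big1 ?mulr1 // => i /last_m->.
by rewrite expr0.
Qed.

Lemma only_last_var_clears (q : {mpoly Qx[n.+1]}) :
  only_last_var q -> exists Q, clears Q q.
Proof.
move=> last_q; have [c c0 [p eqp]] := mpoly_clear_denominators q.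
have fc0 : tofrac c != 0 by rewrite tofrac_eq0.
exists (\sum_(m <- msupp p) p@_m *: 'X^(m ord_max)); exists (tofrac c)^-1.
  by rewrite invr_eq0.
rewrite in_last_varE -last_var_mpoly_sum -?eqp ?scalerA ?mulVf ?scale1r // => m mp.
apply: last_q; rewrite mcoeff_msupp; apply: contraTneq mp => q0.
rewrite mcoeff_msupp negbK -(tofrac_eq0 p@_m) -mcoeff_map_mpoly -eqp mcoeffZ q0.
by rewrite mulr0.
Qed.

End LastVariable.

(** * The system evaluated at the enumerators *)

Section System.
Variables (C D E : set nat).
Hypotheses (C0 : 0%N \notin C) (D0 : 0%N \notin D) (E0 : 0%N \notin E).
Variables (n : nat) (e : 'I_n.+1 -> path_family).
Hypothesis e_var : variable_assignment C D E e.

Lemma var_indexK s : descendant C D E s -> e (var_index e s) = s.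
Proof.
move=> ds; have [[_ _ /(_ _ ds)[i _ eqi]] _] := e_var.
rewrite /var_index; case: pickP => [j /eqP//|/(_ i)].
by rewrite eqi eqxx.
Qed.

Let point (i : 'I_n.+1) : fps := family_gf C D E (e i).

(** The coefficients of the equations lie in Q[x], so each equation can be read over Q[x] and
    evaluated at the enumerators, where the rules hold because every descendant is regular. *)
Lemma system_vanishes i : exists2 b : {mpoly {poly rat}[n.+1]},
  system C D E e i = map_mpoly (@tofrac {poly rat}) b & mmap poly_fps point b = 0.
Proof.
exists ('X_i - rule_value ('X)%:MP (fun s => 'X_(var_index e s)) C D E (e i)).
  rewrite raddfB /= map_mpolyX rule_value_rmorph /= map_mpolyC; congr (_ - _).
  by apply: eq_rule_value => u _ /=; rewrite map_mpolyX.
have de : descendant C D E (e i) by have [[e_desc _ _] _] := e_var; apply: e_desc.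
rewrite raddfB /= mmapX mmap1U rule_value_rmorph /= mmapC.
apply/eqP; rewrite subr_eq0 /point family_gf_rule ?(regular_descendant C0 D0 E0) //.
(* Children of a descendant are descendants, so [var_index] does not return its default value
   here. *)
apply/eqP/eq_rule_value => u u_child /=; rewrite mmapX mmap1U var_indexK //.
exact: descendant_child u_child.
Qed.

Let I := ideal_gen [set system C D E e i | i in [set: 'I_n.+1]].

Lemma clears_ideal_vanishes q Q : I q -> clears Q q -> eval_fps Q (f_gf C D E) = 0.
Proof.
move=> Iq [c0 c00 eqq].
have [b [i _ <-]|c c_neq0 [p eqp p0]] := @ideal_clear_denominators _ _ _ poly_fps point _ q _ Iq.
  exact: system_vanishes.
have [v v0 [u equ]] := fraction_denominator c0.
have u0 : u != 0 by rewrite -tofrac_eq0 -equ mulf_eq0 tofrac_eq0 (negPf v0) (negPf c00).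
(* Both sides are [q] scaled by [tofrac (c * v)]: [c] clears the ideal combination and [v] the unit
   [c0] relating [q] to [Q]. Injectivity then gives an equality over Q[x]. *)
have eqQ : map_mpoly (@tofrac {poly rat}) (last_var_mpoly n ((c * u) *: Q)) =
    map_mpoly (@tofrac {poly rat}) (v *: p).
  rewrite map_mpolyZ -eqp -in_last_varE in_last_varZ eqq !scalerA tofracM -equ.
  by rewrite mulrA [tofrac c * _]mulrC.
have := congr1 (mmap poly_fps point) (map_tofrac_inj eqQ).
rewrite mmapZ p0 mulr0 mmap_last_var_mpoly => /eval_fps_scale_eq0.
rewrite mulf_neq0 // => /(_ isT).
by rewrite /point; have [_ ->] := e_var; rewrite /= -f_gfE.
Qed.

End System.

Lemma vanishes_on_termsE C D E m F :
  vanishes_on_terms C D E m F <->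
  forall t, (t < m)%N -> fps_coef (eval_fps F (f_gf C D E)) t = 0.
Proof.
split=> F0 t tm; first by rewrite (eval_fps_trunc _ _ tm); apply: F0.
by rewrite -[LHS](eval_fps_trunc F (f_gf C D E) tm); apply: F0.
Qed.

Lemma complete_factorization_zero (f : fps) Q k (q : 'I_k -> {poly {poly rat}}) d :
  complete_factorization Q q d -> eval_fps Q f = 0 -> exists i, eval_fps (q i) f = 0.
Proof.
move=> [_ _ _ [u uu ->]]; rewrite eval_fpsM => /fps_mulf_eq0[/(eval_fps_unit uu)//|].
apply: contraPP => no_i; elim/big_ind: _ => [|P R P0 R0|i _].
- by rewrite eval_fps1 => /eqP; rewrite oner_eq0.
- by rewrite eval_fpsM => /fps_mulf_eq0[].
elim: (d i) => [|k' IHk']; first by rewrite eval_fps1 => /eqP; rewrite oner_eq0.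
rewrite exprS eval_fpsM => /fps_mulf_eq0[qi|//].
by apply: no_i; exists i.
Qed.

Lemma unique_vanishing_factor C D E Q k (q : 'I_k -> {poly {poly rat}}) d :
  complete_factorization Q q d -> eval_fps Q (f_gf C D E) = 0 ->
  exists2 i, desired C D E (q i) &
    exists M : nat, forall m, (M <= m)%N ->
      forall j, vanishes_on_terms C D E m (q j) <-> j = i.
Proof.
move=> facQ Q0; have [i qi] := complete_factorization_zero facQ Q0.
have [irr_q nassoc _ _] := facQ; exists i; first by split=> //; case: (irr_q i).
have bound j : exists N, j != i -> exists2 t, (t < N)%N &
    fps_coef (eval_fps (q j) (f_gf C D E)) t != 0.
  (* The vanishing factor itself imposes no bound; any other factor has a nonzero coefficient at
     some [t], and [t.+1] terms reveal it. *)
  case: (eqVneq j i) => [_|ne_ji]; first by exists 0%N.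
  apply: contrapT => noN; apply: (nassoc _ _ ne_ji).
  apply: irreducible_zero_uniq (irr_q j) (irr_q i) _ qi.
  apply: fpsP => t; rewrite /= coef0; apply: contrapT => /eqP qt.
  by apply: noN; exists t.+1 => _; exists t.
have [N NP] := choice bound; exists (\max_j N j) => m leNm j.
rewrite vanishes_on_termsE; split=> [van_j|-> t _]; last by rewrite qi /= coef0.
apply/eqP; apply: contrapT => /negP /NP[t tN].
by rewrite van_j ?eqxx // (leq_trans tN) // (leq_trans _ leNm) // leq_bigmax.
Qed.

Theorem mainTheorem3 (C D E : set nat)
  (finC : finite_set C) (finD : finite_set D) (finE : finite_set E)
  (posC : 0%N \notin C) (posD : 0%N \notin D) (posE : 0%N \notin E) :
  [/\ f_gf C D E = h_gf C C D D E E E,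
   forall C1 D1 E1 E2 : set nat, 0%N \notin E1 -> 0%N \notin E2 ->
     h_gf C C1 D D1 E E1 E2 =
       H_gf C C1 D D1 E E1 E2
       + H_gf C C1 D (with0 D) E E1 E2 * h_gf C C D D E E E
         * H_gf C (with0 C) D D1 E E1 E2,
   forall C1 D1 E1 E2 : set nat, admissible C1 D1 E1 E2 ->
     let H := H_gf C C1 D D1 E E1 E2 in
     [/\ 0%N \in E1 ->
           H = fps_x * H_gf C C D D1 E (prime_set E1) E2,
         (* 0 enters E2 only through Case 6, where 0 is in C1; when 0 is not in
            C1, this equation fails for the flat paths. *)
         0%N \notin E1 -> 0%N \in E2 -> 0%N \in C1 ->
           H = fps_x * H_gf C C1 D D E E1 (prime_set E2) &
         0%N \notin E1 -> 0%N \notin E2 ->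
         [/\ 0%N \in C1 -> 0%N \in D1 ->
               H = fps_x ^+ 2
                   * h_gf C (prime_set C1) D (prime_set D1) E E E,
             0%N \notin C1 -> 0%N \notin D1 ->
               H = H_gf C (with0 C1) D D1 E E E2
                   + H_gf C C1 D D1 E (with0 E1) E2 + 1,
             0%N \notin C1 -> 0%N \in D1 ->
               H = H_gf C (with0 C1) D D1 E E E2
                   + H_gf C C1 D D1 E (with0 E1) E2 &
             0%N \in C1 -> 0%N \notin D1 ->
               H = H_gf C C1 D (with0 D1) E E1 E2
                   + H_gf C C1 D D1 E E1 (with0 E2)]],
   finite_set (descendant C D E)
   /\ (forall s, descendant C D E s ->
         family_gf C D E s = rule_value fps_x (family_gf C D E) C D E s) &
   forall (n : nat) (e : 'I_n.+1 -> path_family), variable_assignment C D E e ->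
     let I := ideal_gen [set system C D E e i | i in [set: 'I_n.+1]] in
     (exists2 p, elimination_ideal_last I p & p != 0) ->
     (exists G, reduced_groebner_basis I G) /\
     (forall G, reduced_groebner_basis I G ->
       (exists q, smallest_element G q) /\
       (forall q, smallest_element G q ->
         [/\ only_last_var q,
             exists Q, clears Q q &
             forall Q, clears Q q ->
             [/\ eval_fps Q (f_gf C D E) = 0,
                 exists k (qs : 'I_k -> {poly {poly rat}}) (ds : 'I_k -> nat),
                   complete_factorization Q qs ds &
                 forall k (qs : 'I_k -> {poly {poly rat}}) (ds : 'I_k -> nat),
                   complete_factorization Q qs ds ->
                   (k = 1%N -> forall i, desired C D E (qs i)) /\
                   (k <> 1%N ->
                      exists2 i, desired C D E (qs i) &
                        exists M : nat, forall m, (M <= m)%N ->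
                          forall j, vanishes_on_terms C D E m (qs j)
                                    <-> j = i)]]))].

Proof.
split; first exact: f_gfE.
- by move=> C1 D1 E1 E2 E10 E20; apply: h_gf_split.
- move=> C1 D1 E1 E2 /andP[nCE nDE] /=; split.
  + move=> E10; apply: H_gf_initial_Flat => //.
    by move: nCE; rewrite E10 andbT.
  + move=> E10 E20 C10; apply: H_gf_final_Flat => //.
    by move: nDE; rewrite E20 andbT.
  + move=> E10 E20; split=> [C10 D10|C10 D10|C10 D10|C10 D10].
    * exact: H_gf_elevated.
    * by rewrite H_gf_initial_split // D10.
    * by rewrite H_gf_initial_split // D10 addr0.
    * exact: H_gf_final_split.
- split; first exact: finite_descendant.
  by move=> s ds; apply: family_gf_rule => //; apply: regular_descendant ds.
move=> n e e_var I [p Ip p0]; split; first exact: exists_reduced_groebner_basis.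
move=> G [gbG _]; split.
  have [g gG /(divides_lead_term p0)[g0 _]] := gbG.2 p Ip.1 p0.
  exact: exists_smallest_element gG g0.
move=> q small_q; have last_q := smallest_element_only_last_var gbG Ip p0 small_q.
have [qG q0 _] := small_q; have Iq := gbG.1 q qG.
split=> //; first exact: only_last_var_clears.
move=> Q clQ; have Qf := clears_ideal_vanishes posC posD posE e_var Iq clQ.
have Q0 : Q != 0.
  apply/negP => /eqP Q0; have [c _ eqq] := clQ.
  by case/eqP: q0; rewrite eqq Q0 in_last_varE /last_var_mpoly map_poly0 horner0 raddf0 scaler0.
split=> //; first exact: exists_complete_factorization.
move=> k qs ds fac; have [i qi Mi] := unique_vanishing_factor fac Qf.
split=> [k1 j|_]; last by exists i.
suff -> : j = i by [].
by subst k; rewrite (ord1 i) (ord1 j).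
Qed.
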